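(* Let $Q \in \{\Sigma,\Pi\}$, let $g$ be a function with $g(n)\ge 1$, and let $M$ be a $Q^E_{g(n)}$-machine, i.e. an alternating Turing machine whose initial state is existential if $Q=\Sigma$ and universal if $Q=\Pi$, with running time $2^{q(n)}$ for some polynomial $q$ and at most $g(n)$ alternations. Then there exist a polynomial $h$ and a single-query oracle $\Sigma^P_4$-machine $N$ such that for every input $x$, $M$ accepts $x$ if and only if \[ \Game_1 A_1\, \Game_2 A_2 \ldots \Game_{g(|x|)} A_{g(|x|)} \;:\; N \text{ accepts } x \text{ with oracle } \langle A_1,\ldots,A_{g(|x|)}\rangle, \] where $\Game_1,\Game_2,\ldots$ is an alternating sequence of quantifiers starting with $\exists$ if $Q=\Sigma$ and with $\forall$ if $Q=\Pi$, and each $A_i$ ranges over subsets of $\{0,1\}^{h(|x|)}$.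
   Context: The number of alternations of an alternating machine is the maximal number of transitions between universal and existential states on inputs of length $n$, counting the initial configuration as the first alternation. A $\Sigma^P_4$-machine is an alternating Turing machine starting in an existential state, running in polynomial time, with at most $4$ alternations. An oracle machine queries its oracle by writing a word on the oracle tape and entering a query state; a single-query oracle machine asks at most one oracle question. For sets $A_1,\ldots,A_k$, $\langle A_1,\ldots,A_k\rangle = \{\langle i,x\rangle : x\in A_i,\ 1\le i\le k\}$ (efficient disjoint union). *)

(* Defs.v *)
From Stdlib Require List.
From mathcomp Require Import all_boot.
Set Implicit Arguments. Unset Strict Implicit. Unset Printing Implicit Defensive.

Definition polyn (cs : seq nat) (n : nat) : nat :=
  \sum_(i < size cs) nth 0 cs i * n ^ i.

(* Alternating multi-tape Turing machines with an (optional) oracle.        *)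
(*  - a read-only input tape holding the input word (then blanks);          *)
(*  - ntapes.+1 work tapes; work tape ord0 is the oracle tape;              *)
(*  - every state has a kind: existential, universal, accepting, rejecting; *)
(*  - qry = Some (q, qyes, qno) for oracle machines: in state q the word    *)
(*    written on the oracle tape is asked and the machine moves to qyes or  *)
(*    qno according to the oracle answer.                                   *)
Inductive skind := KEx | KUn | KAcc | KRej.
Inductive move := ML | MS | MR.

Record ATM := {
  St : finType;
  Gam : finType;
  blank : Gam;
  sym : bool -> Gam;
  sym_inj : injective sym;
  sym_blank : forall b, sym b != blank;
  ntapes : nat;
  kind : St -> skind;
  start : St;
  qry : option (St * St * St);
  delta : St -> Gam -> {ffun 'I_ntapes.+1 -> Gam} ->
          seq (St * move * {ffun 'I_ntapes.+1 -> Gam * move})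
}.

Record cfg (M : ATM) := Cfg {
  cst : St M;
  ihead : nat;
  tapes : {ffun 'I_(ntapes M).+1 -> seq (Gam M) * nat}
}.

Definition mv (m : move) (p : nat) : nat :=
  match m with ML => p.-1 | MS => p | MR => p.+1 end.

Section Semantics.
Variable M : ATM.
Implicit Types (x : seq bool) (O : seq bool -> Prop) (c : cfg M).

Definition decode (s : seq (Gam M)) : seq bool :=
  foldr (fun a acc => match [pick b | sym M b == a] with
                      | Some b => b :: acc | None => [::] end) [::] s.

Definition init_cfg : cfg M :=
  @Cfg M (start M) 0 [ffun _ => ([::], 0)].

Definition apply_tr c (tr : St M * move * {ffun 'I_(ntapes M).+1 -> Gam M * move})
  : cfg M :=
  let: (s', mi, f) := tr in
  @Cfg M s' (mv mi (ihead c))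
    [ffun i => let: (tp, pos) := tapes c i in
               (set_nth (blank M) tp pos (f i).1, mv (f i).2 pos)].

Definition set_state c (s : St M) : cfg M := @Cfg M s (ihead c) (tapes c).

Definition oracle_word c : seq bool := decode (tapes c ord0).1.

Definition is_query_state (s : St M) : bool :=
  if qry M is Some (q, _, _) then s == q else false.

Definition succ x O c c' : Prop :=
  match qry M with
  | Some (q, qy, qn) =>
      if cst c == q then
        (O (oracle_word c) /\ c' = set_state c qy) \/
        (~ O (oracle_word c) /\ c' = set_state c qn)
      else
        match kind (cst c) with
        | KAcc | KRej => False
        | _ => exists tr, List.In tr (delta (cst c) (nth (blank M) (map (sym M) x) (ihead c))
                          [ffun i => nth (blank M) (tapes c i).1 (tapes c i).2])
                   /\ c' = apply_tr c tr
        end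
  | None =>
      match kind (cst c) with
      | KAcc | KRej => False
      | _ => exists tr, List.In tr (delta (cst c) (nth (blank M) (map (sym M) x) (ihead c))
                          [ffun i => nth (blank M) (tapes c i).1 (tapes c i).2])
                 /\ c' = apply_tr c tr
      end
  end.

Inductive accepts x O : cfg M -> Prop :=
| acc_acc c : ~~ is_query_state (cst c) -> kind (cst c) = KAcc -> accepts x O c
| acc_ex c c' : ~~ is_query_state (cst c) -> kind (cst c) = KEx ->
    succ x O c c' -> accepts x O c' -> accepts x O c
| acc_un c : ~~ is_query_state (cst c) -> kind (cst c) = KUn ->
    (forall c', succ x O c c' -> accepts x O c') -> accepts x O c
| acc_q c c' : is_query_state (cst c) -> succ x O c c' -> accepts x O c' ->
    accepts x O c.

Definition accepts_with x O : Prop := accepts x O init_cfg.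

Fixpoint is_path x O c (cs : seq (cfg M)) : Prop :=
  match cs with
  | [::] => True
  | c' :: cs' => succ x O c c' /\ is_path x O c' cs'
  end.

Definition time_bounded (T : nat -> nat) : Prop :=
  forall x O cs, is_path x O init_cfg cs -> size cs <= T (size x).

(* alternations along a path: the number of maximal blocks of existential/ *)
(* universal states (query states, being deterministic, are ignored);     *)
(* the initial block counts as the first alternation                       *)
Definition label c : option bool :=
  if is_query_state (cst c) then None else
  match kind (cst c) with KEx => Some true | KUn => Some false | _ => None end.

Fixpoint switches (b : bool) (s : seq bool) : nat :=
  match s with [::] => 0 | b' :: s' => (b != b') + switches b' s' end.

Definition nblocks (s : seq bool) : nat :=
  if s is b :: s' then (switches b s').+1 else 0.

Definition alt_bounded (a : nat -> nat) : Prop :=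
  forall x O cs, is_path x O init_cfg cs ->
    nblocks (pmap label (init_cfg :: cs)) <= a (size x).

Definition single_query : Prop :=
  forall x O cs, is_path x O init_cfg cs ->
    count (fun c => is_query_state (cst c)) (init_cfg :: cs) <= 1.

End Semantics.

Definition QE_machine (Qsig : bool) (g : nat -> nat) (M : ATM) : Prop :=
  qry M = None /\
  kind (start M) = (if Qsig then KEx else KUn) /\
  (exists q : seq nat, time_bounded M (fun n => 2 ^ polyn q n)) /\
  alt_bounded M g.

Definition SigmaP4_single_query_oracle (N : ATM) : Prop :=
  kind (start N) = KEx /\
  (exists p : seq nat, time_bounded N (polyn p)) /\
  alt_bounded N (fun _ => 4) /\
  single_query N.

Fixpoint bin_aux (fuel n : nat) : seq bool :=
  match fuel with
  | 0 => [::]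
  | f.+1 => if n is 0 then [::] else odd n :: bin_aux f n./2
  end.
Definition bin (n : nat) : seq bool := bin_aux n n.

Definition pair_enc (i : nat) (x : seq bool) : seq bool :=
  flatten (map (fun b => [:: b; b]) (bin i)) ++ [:: false; true] ++ x.

Definition disj_union (As : seq (seq bool -> Prop)) : seq bool -> Prop :=
  fun w => exists i x, 0 < i <= size As /\ w = pair_enc i x /\
                       nth (fun _ => False) As i.-1 x.

Fixpoint game (ex : bool) (k H : nat) (P : seq (seq bool -> Prop) -> Prop) : Prop :=
  match k with
  | 0 => P [::]
  | k'.+1 =>
      if ex then exists A : seq bool -> Prop,
                   (forall w, A w -> size w = H) /\ game (~~ ex) k' H (fun As => P (A :: As))
      else forall A : seq bool -> Prop,
                   (forall w, A w -> size w = H) -> game (~~ ex) k' H (fun As => P (A :: As))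
  end.

(* Main.v *)
(* The run of M is cut into blocks, one per quantifier: A_i describes, cell by *)
(* cell, the part of the run played by the owner of block i, as a function of  *)
(* (time, tape cell) addressed by words of polynomial length. Every row of the *)
(* tableau follows from its neighbours by a rule on two cells, so a fault of a *)
(* player is witnessed by a window of two cells, and the player who commits    *)
(* the first fault loses. The referee N existentially guesses a fault of the   *)
(* universal player, or an accepting end of a block, together with the oracle  *)
(* bits it reads there; then it universally either has one of these bits       *)
(* checked, or picks an alleged earlier fault of the existential player, of    *)
(* which N existentially points out a wrongly alleged bit. One query suffices  *)
(* on each branch, and three alternations are used. Windows are words with     *)
(* several tracks and their well-formedness is checked by a finite automaton;  *)
(* their length is measured by an odometer of bouncing tape heads.             *)
Require Import Defs.
From HB Require Import structures.
From mathcomp Require Import all_boot ssralg poly zify.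
From mathcomp Require Import boolp.
Set Implicit Arguments. Unset Strict Implicit. Unset Printing Implicit Defensive.

(** A run of [M] is exponentially long, but it is a tableau whose correctness is local, and its
    cells can be addressed by words of polynomial length [L] as soon as [2 ^ L.-1] exceeds the
    running time. The set chosen at quantifier [i] holds the rows during which the owner of that
    quantifier moves; when that player is no longer to move, the rows repeat. A block is longer than
    any run, so its owner has certainly stopped at its end, and a run still active there has used up
    one more alternation ([bsteps_reach]). Hence after [g] blocks the run has halted.

    Acceptance is compatible with playing a whole block ([acc_bsteps_ex], [acc_bsteps_un]), a set
    without faults describes a genuine block ([valid_sound]), and every genuine block is described
    by some such set ([honest_block]). A faulty set gains nothing, since the first fault decides the
    game. Induction on the number of remaining quantifiers then identifies the game with acceptance
    ([game_acc], with the invariant [inv]).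

    It remains to evaluate the winning condition with one query per branch ([window_verifier]). It
    has the form: there are a fault of the universal player, or an accepting end, and claimed oracle
    bits, such that each of these bits is correct and, for every alleged earlier fault of the
    existential player, some alleged bit is wrong. Apart from the final oracle bit this is an
    exists-forall-exists formula about words, so each branch ends in one query. [verifier] builds
    the machine for every formula of this shape whose matrix is computed by a finite automaton
    ([regular]); therefore all comparisons of addresses, block numbers and input positions are made
    by automata.

    The number of quantifiers may exceed every number that fits in a window. This does no harm: a
    run has at most one block more than it has steps, so the deciding fault or accepting end lies in
    an early block ([early_win]). *)

Lemma In_mem (T : eqType) (x : T) s : x \in s <-> List.In x s.
Proof.
elim: s => [|y s IH] //=; rewrite in_cons; split.
  by case/orP => [/eqP->|/IH]; [left|right].
by case=> [->|/IH->]; rewrite ?eqxx ?orbT.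
Qed.

Lemma In_map (S T : Type) (f : S -> T) y s :
  List.In y (map f s) <-> exists x, List.In x s /\ y = f x.
Proof.
elim: s => [|a s IH]; first by split=> // -[? []].
split.
  case=> [<-|h]; first by exists a; split=> //; left.
  by case: (IH.1 h) => x [h1 ->]; exists x; split=> //; right.
by case=> x [[<-|h] e]; [left|right; apply/IH; exists x].
Qed.

Lemma In_cat (T : Type) (y : T) s1 s2 :
  List.In y (s1 ++ s2) <-> List.In y s1 \/ List.In y s2.
Proof. by elim: s1 => [|a s IH] /=; [split; [right|case] | rewrite IH; tauto]. Qed.

Lemma In_flatten_map (S T : Type) (f : S -> seq T) y s :
  List.In y (flatten (map f s)) <-> exists x, List.In x s /\ List.In y (f x).
Proof.
elim: s => [|a s IH] /=; first by split=> // -[? []].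
rewrite In_cat IH; split.
  case=> [h|[x [h1 h2]]]; [by exists a; split=> //; left|by exists x; split=> //; right].
by case=> x [[<-|h1] h2]; [left|right; exists x].
Qed.

Lemma set_nth_cat_size (T : Type) (a : T) s1 b b' s2 :
  set_nth a (s1 ++ b :: s2) (size s1) b' = s1 ++ b' :: s2.
Proof. by elim: s1 => //= c s ->. Qed.

Lemma set_nth_size (T : Type) (a : T) s b : set_nth a s (size s) b = rcons s b.
Proof. by elim: s => //= c s ->. Qed.

Lemma pmap_rcons (S T : Type) (f : S -> option T) s x :
  pmap f (rcons s x) = pmap f s ++ seq_of_opt (f x).
Proof. by elim: s => [|y s IH] /=; [case: (f x) | rewrite IH; case: (f y)]. Qed.

(** * Runs of alternating machines *)

Section Runs.
Variables (M : ATM) (x : seq bool) (O : seq bool -> Prop).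
Implicit Type c : cfg M.

Lemma accepts_rejE c : ~~ is_query_state (cst c) -> kind (cst c) = KRej ->
  ~ accepts x O c.
Proof.
move=> nq k a; case: a nq k => {}c; try solve [by move=> _ -> | by move=> ? _ -> | by move=> ? ->].
Qed.

Lemma accepts_exE c : ~~ is_query_state (cst c) -> kind (cst c) = KEx ->
  accepts x O c <-> exists c', succ x O c c' /\ accepts x O c'.
Proof.
move=> nq k; split; last by case=> c' [? ?]; apply: acc_ex k _ _; eauto.
move=> a; case: a nq k => {}c; try solve [by move=> _ -> | by move=> ? _ -> | by move=> ? ->].
  by move=> c'; eauto.
Qed.

Lemma accepts_unE c : ~~ is_query_state (cst c) -> kind (cst c) = KUn ->
  accepts x O c <-> forall c', succ x O c c' -> accepts x O c'.
Proof.
move=> nq k; split; last by move=> h; exact: acc_un k h.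
move=> a; case: a nq k => {}c; try solve [by move=> _ -> | by move=> ? _ -> | by move=> ? ->].
Qed.

Lemma accepts_queryE c : is_query_state (cst c) ->
  accepts x O c <-> exists c', succ x O c c' /\ accepts x O c'.
Proof.
move=> q; split; last by case=> c' [? ?]; apply: acc_q; eauto.
move=> a; case: a q => {}c; try solve [by move/negbTE-> | by move=> ? /negbTE->].
by move=> c' _; eauto.
Qed.

Definition path_bounds c b T a q := forall cs, is_path x O c cs ->
  [/\ size cs <= T, switches b (pmap (@label M) (c :: cs)) <= a
    & count (fun c => is_query_state (cst c)) (c :: cs) <= q].

(* [b] is the owner of the block that [c] is about to continue. *)
Definition run_spec c b T a q (P : Prop) :=
  (accepts x O c <-> P) /\ path_bounds c b T a q.

Lemma path_bounds_step c b b' T a q : label c = Some b' ->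
  (forall c', succ x O c c' -> path_bounds c' b' T a q) ->
  path_bounds c b T.+1 ((b != b') + a) q.
Proof.
move=> lb h [_|c' cs [s p]].
  rewrite /= lb /= addn0 leq_addr; split=> //.
  by move: lb; rewrite /label; case: is_query_state.
have [h1 h2 h3] := h _ s _ p.
rewrite [size _]/= ltnS h1 [pmap _ _]/= lb; split=> //.
  by rewrite [switches _ _]/= leq_add2l.
rewrite [count _ _]/=; move: lb; rewrite /label; case: is_query_state => //.
Qed.

Lemma path_bounds_query c b T a q : is_query_state (cst c) ->
  (forall c', succ x O c c' -> path_bounds c' b T a q) ->
  path_bounds c b T.+1 a q.+1.
Proof.
move=> qs h; have lb : label c = None by rewrite /label qs.
case=> [_|c' cs [s p]]; first by rewrite /= lb qs.
have [h1 h2 h3] := h _ s _ p.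
rewrite [size _]/= ltnS h1 [pmap _ _]/= lb; split=> //.
by rewrite [count _ _]/= qs.
Qed.

Lemma run_spec_le c b T a q P T' a' q' P' : run_spec c b T a q P ->
  T <= T' -> a <= a' -> q <= q' -> (P <-> P') -> run_spec c b T' a' q' P'.
Proof.
move=> [h1 h2] lT la lq e; split; first by rewrite h1.
by move=> cs /h2 [u1 u2 u3]; split; [apply: leq_trans lT|apply: leq_trans la|apply: leq_trans lq].
Qed.

End Runs.

(** * A generic three-stage verifier *)

Section Families.
Variable d : nat.

(* Tape 0 is the oracle tape, tape 1 the main work tape, the rest are clocks. *)
Definition fam (T : Type) (o w : T) (c : 'I_d -> T) (i : 'I_d.+2) : T :=
  if unlift ord0 i is Some j then
    if unlift ord0 j is Some k then c k else w
  else o.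

Definition wtape : 'I_d.+2 := lift ord0 ord0.
Definition ctape (k : 'I_d) : 'I_d.+2 := lift ord0 (lift ord0 k).

Lemma fam0 T (o w : T) c : fam o w c ord0 = o.
Proof. by rewrite /fam unlift_none. Qed.

Lemma famw T (o w : T) c : fam o w c wtape = w.
Proof. by rewrite /fam liftK unlift_none. Qed.

Lemma famc T (o w : T) c k : fam o w c (ctape k) = c k.
Proof. by rewrite /fam !liftK. Qed.

Lemma fam_ind (P : 'I_d.+2 -> Prop) :
  P ord0 -> P wtape -> (forall k, P (ctape k)) -> forall i, P i.
Proof.
move=> p0 pw pc i; case: (unliftP ord0 i) => [j ->|-> //].
by case: (unliftP ord0 j) => [k ->|->]; [exact: pc|exact: pw].
Qed.

End Families.

Section Verifier.
Variables (F X K V : finType) (d : nat).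
Notation Y := (X * option bool * X)%type.
Variables (v0 : V) (stp : Y -> V -> V).
Variables (ut : F -> F -> V -> seq (K * bool))
          (et : F -> F -> V -> option (seq (K * bool))).
Variables (em1 em2 : K -> Y -> seq bool) (tag : K -> seq bool).

(** [Mk] belongs to the clocks. On the work tape [Hd] is the left end and carries the guessed claim,
    [Bd] is a letter of the first window with its input symbol, [Bd2] adds the letter of the second
    window, and [Ans] keeps the expected answer during the query. *)
Inductive gam := Blk | Bit of bool | Mk of option bool | Hd of F
  | Bd of X & option bool | Bd2 of Y | Ans of bool.

Definition gam_enc g : option (bool + option bool + F + X * option bool + Y + bool) :=
  match g with
  | Blk => None
  | Bit b => Some (inl (inl (inl (inl (inl b)))))
  | Mk m => Some (inl (inl (inl (inl (inr m)))))
  | Hd f => Some (inl (inl (inl (inr f))))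
  | Bd x z => Some (inl (inl (inr (x, z))))
  | Bd2 y => Some (inl (inr y))
  | Ans b => Some (inr b)
  end.
Definition gam_dec g := match g with
  | None => Blk
  | Some (inl (inl (inl (inl (inl b))))) => Bit b
  | Some (inl (inl (inl (inl (inr m))))) => Mk m
  | Some (inl (inl (inl (inr f)))) => Hd f
  | Some (inl (inl (inr (x, z)))) => Bd x z
  | Some (inl (inr y)) => Bd2 y
  | Some (inr b) => Ans b
  end.
Lemma gam_encK : cancel gam_enc gam_dec. Proof. by case. Qed.
HB.instance Definition _ := Finite.copy gam (can_type gam_encK).

(* What the forward ([dir]) or backward emission sweep appends to the oracle *)
(* tape on a work-tape symbol; the blank is the right end of the word.       *)
Definition emw (dir : bool) (k : K) (g : gam) : seq bool :=
  match g with
  | Bd2 y => if dir then em1 k y else em2 k y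
  | Blk => [:: false; true]
  | Hd _ => tag k
  | _ => [::]
  end.

Definition emax := \max_(u : bool * K * gam) size (emw u.1.1 u.1.2 u.2).

Lemma size_emw dir k g : size (emw dir k g) <= emax.
Proof. exact: (leq_bigmax (dir, k, g)). Qed.

(** [S0], [S1] and [Tk] guess the first window, along the input and then along the clocks; [Sw]
    guesses the second one universally while running the automaton; [Ex] makes the last existential
    choice. The number in [Em] counts the bits already emitted for the current letter. *)
Inductive st := S0 | S1 | Tk of {ffun 'I_d -> bool} | Sw of V | Ex of F & F & V
  | Em of bool & K & bool & 'I_emax.+1 | Qy | An of bool | Hl of bool.

Definition st_enc s : option (option (option
    ({ffun 'I_d -> bool} + V + (F * F * V) + (bool * K * bool * 'I_emax.+1) + bool + bool))) :=
  match s with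
  | S0 => None
  | S1 => Some None
  | Qy => Some (Some None)
  | Tk ds => Some (Some (Some (inl (inl (inl (inl (inl ds)))))))
  | Sw v => Some (Some (Some (inl (inl (inl (inl (inr v)))))))
  | Ex f f' v => Some (Some (Some (inl (inl (inl (inr (f, f', v)))))))
  | Em i k b j => Some (Some (Some (inl (inl (inr (i, k, b, j))))))
  | An b => Some (Some (Some (inl (inr b))))
  | Hl b => Some (Some (Some (inr b)))
  end.
Definition st_dec s := match s with
  | None => S0
  | Some None => S1
  | Some (Some None) => Qy
  | Some (Some (Some (inl (inl (inl (inl (inl ds))))))) => Tk ds
  | Some (Some (Some (inl (inl (inl (inl (inr v))))))) => Sw v
  | Some (Some (Some (inl (inl (inl (inr (f, f', v))))))) => Ex f f' v
  | Some (Some (Some (inl (inl (inr (i, k, b, j)))))) => Em i k b j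
  | Some (Some (Some (inl (inr b)))) => An b
  | Some (Some (Some (inr b))) => Hl b
  end.
Lemma st_encK : cancel st_enc st_dec. Proof. by case. Qed.
HB.instance Definition _ := Finite.copy st (can_type st_encK).

Record act := Act { a_st : st; a_in : move; a_out : option bool;
                    a_w : gam * move; a_cl : 'I_d -> gam * move }.

Definition atend b g := g == Mk (Some b).

(* The clocks form an odometer whose digits bounce between the two marks. *)
Definition firstfree (ds : {ffun 'I_d -> bool}) (rc : {ffun 'I_d -> gam}) :=
  [pick j | ~~ atend (ds j) (rc j) &&
            [forall k : 'I_d, (k < j) ==> atend (ds k) (rc k)]].

Definition flip (ds : {ffun 'I_d -> bool}) (j : 'I_d) : {ffun 'I_d -> bool} :=
  [ffun k : 'I_d => if k < j then ~~ ds k else ds k].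

Definition ckmove (ds : {ffun 'I_d -> bool}) (rc : {ffun 'I_d -> gam})
    (j k : 'I_d) : gam * move :=
  (rc k, if k == j then if ds k then MR else ML else MS).

(** The universal branching at the left end. A claim [f'] with [et f f' v = None] yields no [inr]
    branch, so it imposes no obligation on the last stage. *)
Definition choices (f : F) (v : V) : seq (K * bool + F) :=
  flatten [seq [seq inl kb | kb <- ut f f' v] ++
               (if et f f' v is Some _ then [:: inr f'] else [::]) | f' <- enum F].

(** The query state cannot remember anything, so [Ans b] is written over the left-end letter just
    before the query and compared with the answer just after it. *)
Definition nd (s : st) (g w : gam) (rc : {ffun 'I_d -> gam}) : seq act :=
  let idle k := (rc k, MS) in
  match s with
  | S0 => [seq Act S1 MS None (Hd f, MR) (fun=> (Mk (Some false), MR)) | f <- enum F]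
  | S1 => match g with
    | Bit b => [seq Act S1 MR None (Bd x (Some b), MR) (fun=> (Mk None, MR)) | x <- enum X]
    | Blk => [seq Act (Tk [ffun=> false]) MS None (Bd x None, MR)
                      (fun=> (Mk (Some true), MS)) | x <- enum X]
    | _ => [::]
    end
  | Tk ds =>
    if firstfree ds rc is Some j then
      [seq Act (Tk (flip ds j)) MS None (Bd x None, MR) (ckmove ds rc j) | x <- enum X]
    else [:: Act (Sw v0) MS None (w, ML) idle]
  | Sw v => match w with
    | Bd x z => [seq Act (Sw (stp (x, z, x') v)) MS None (Bd2 (x, z, x'), ML) idle
                | x' <- enum X]
    | Hd f => [seq match i with
                   | inl kb => Act (Em true kb.1 kb.2 ord0) MS None (w, MR) idle
                   | inr f' => Act (Ex f f' v) MS None (w, MS) idle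
                   end | i <- choices f v]
    | _ => [::]
    end
  | Ex f f' v => [seq Act (Em true kb.1 kb.2 ord0) MS None (w, MR) idle
                 | kb <- odflt [::] (et f f' v)]
  | Em dir k b j =>
    if j < size (emw dir k w) then
      [:: Act (Em dir k b (inord j.+1)) MS (Some (nth false (emw dir k w) j)) (w, MS) idle]
    else match w with
      | Bd2 _ => [:: Act (Em dir k b ord0) MS None (w, if dir then MR else ML) idle]
      | Blk => [:: Act (Em false k b ord0) MS None (w, ML) idle]
      | Hd _ => [:: Act Qy MS None (Ans b, MS) idle]
      | _ => [::]
      end
  | An b => match w with
    | Ans b' => [:: Act (Hl (b == b')) MS None (w, MS) idle]
    | _ => [::]
    end
  | _ => [::]
  end.

Definition nkind s :=
  match s with Sw _ => KUn | Hl true => KAcc | Hl false => KRej | _ => KEx end.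

Definition act_tr (g0 : gam) (a : act) :
    st * move * {ffun 'I_d.+2 -> gam * move} :=
  (a_st a, a_in a,
   finfun (fam (if a_out a is Some b then (Bit b, MR) else (g0, MS)) (a_w a) (a_cl a))).

Definition ndelta (s : st) (g : gam) (rd : {ffun 'I_d.+2 -> gam}) :=
  [seq act_tr (rd ord0) a
  | a <- nd s g (rd (wtape d)) [ffun k => rd (ctape k)]].

Lemma Bit_inj : injective Bit. Proof. by move=> ? ? []. Qed.
Lemma Bit_blank b : Bit b != Blk. Proof. by []. Qed.

Definition verifier_machine : ATM :=
  @Build_ATM st gam Blk Bit Bit_inj Bit_blank d.+1 nkind S0
    (Some (Qy, An true, An false)) ndelta.
Notation N := verifier_machine.

(** Tapes are compared as functions, because rewriting a blank beyond the end of the list lengthens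
    the list without changing the tape. *)
Definition teq (a b : seq gam * nat) := a.2 = b.2 /\ nth Blk a.1 =1 nth Blk b.1.

Definition At (c : cfg N) s ih out wt (cl : 'I_d -> seq gam * nat) :=
  [/\ cst c = s, ihead c = ih
    & forall i, teq (tapes c i) (fam (map Bit out, size out) wt cl i)].

Lemma teq_refl a : teq a a. Proof. by []. Qed.

Lemma teq_trans b a c : teq a b -> teq b c -> teq a c.
Proof. by move=> [e1 h1] [e2 h2]; split=> [|k]; rewrite ?e1 ?h1. Qed.

Lemma teq_write a b g m : teq a b ->
  teq (set_nth Blk a.1 a.2 g, mv m a.2) (set_nth Blk b.1 b.2 g, mv m b.2).
Proof. by move=> [e h]; split=> [|k] /=; rewrite ?e // !nth_set_nth /= h. Qed.

Lemma teq_idle l p m : teq (set_nth Blk l p (nth Blk l p), m) (l, m).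
Proof. by split=> // k; rewrite nth_set_nth /=; case: eqP => [->|]. Qed.

Lemma At_teq c s ih out wt cl wt' cl' : At c s ih out wt cl ->
  teq wt wt' -> (forall k, teq (cl k) (cl' k)) -> At c s ih out wt' cl'.
Proof.
move=> [e1 e2 h] hw hc; split=> //; apply: fam_ind.
- by have := h ord0; rewrite !fam0.
- by have := h (wtape d); rewrite !famw => /teq_trans; apply.
- by move=> k; have := h (ctape k); rewrite !famc => /teq_trans; apply.
Qed.

Definition reads_cl (cl : 'I_d -> seq gam * nat) : {ffun 'I_d -> gam} :=
  [ffun k => nth Blk (cl k).1 (cl k).2].

Definition AtA c ih out (wt : seq gam * nat) (cl : 'I_d -> seq gam * nat) (a : act) :=
  At c (a_st a) (mv (a_in a) ih) (out ++ seq_of_opt (a_out a))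
     (set_nth Blk wt.1 wt.2 (a_w a).1, mv (a_w a).2 wt.2)
     (fun k => (set_nth Blk (cl k).1 (cl k).2 (a_cl a k).1, mv (a_cl a k).2 (cl k).2)).

Lemma At_apply c s ih out wt cl a : At c s ih out wt cl ->
  AtA (apply_tr c (act_tr Blk a)) ih out wt cl a.
Proof.
move=> [e1 e2 h]; split=> //=; first by rewrite e2.
apply: fam_ind => [|| k]; rewrite !ffunE ?fam0 ?famw ?famc.
- have [e h0] := h ord0; rewrite fam0 /= in e h0.
  case: (tapes c ord0) e h0 => tp pos /= -> h0; case: (a_out a) => [b|] /=.
    rewrite cats1 map_rcons; split=> /= [|k]; first by rewrite size_rcons.
    by rewrite -(set_nth_size Blk) size_map !nth_set_nth /= h0.
  rewrite cats0; split=> //= k; rewrite nth_set_nth /=; case: eqP => [->|//].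
  by rewrite nth_default ?size_map.
- by move: (h (wtape d)); rewrite famw; case: (tapes c _) => tp pos; exact: teq_write.
- by move: (h (ctape k)); rewrite famc; case: (tapes c _) => tp pos; exact: teq_write.
Qed.

(** * Meaning and cost of the stages, by rules for single steps *)

Section Steps.
Variables (x : seq bool) (O : seq bool -> Prop).

Lemma succ_At c s ih out wt cl c' : At c s ih out wt cl ->
  s != Qy -> nkind s = KEx \/ nkind s = KUn ->
  let l := nd s (nth Blk (map Bit x) ih) (nth Blk wt.1 wt.2) (reads_cl cl) in
  succ x O c c' <-> exists a, List.In a l /\ c' = apply_tr c (act_tr Blk a).
Proof.
move=> [e1 e2 h] nq hk l.
have hr0 : nth Blk (tapes c ord0).1 (tapes c ord0).2 = Blk.
  have [e ->] := h ord0; rewrite e !fam0 /= nth_default ?size_map //.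
have hd : ndelta (cst c) (nth Blk (map Bit x) (ihead c))
   [ffun i => nth Blk (tapes c i).1 (tapes c i).2] = map (act_tr Blk) l.
  rewrite /ndelta !ffunE hr0 e1 e2; congr (map _ (nd _ _ _ _)).
    by have [e ->] := h (wtape d); rewrite e famw.
  apply/ffunP => k; rewrite !ffunE; have [e ->] := h (ctape k).
  by rewrite e famc.
have -> : succ x O c c' <-> exists tr, List.In tr (map (act_tr Blk) l) /\ c' = apply_tr c tr.
  by rewrite /succ /= -hd e1 (negbTE nq); case: hk => ->.
split=> [[tr [/In_map [a [ha ->]] ->]]|[a [ha ->]]]; first by exists a.
by exists (act_tr Blk a); split=> //; apply/In_map; exists a.
Qed.

(** A rule of a calculus: the meaning of an existential configuration is the disjunction of the
    meanings of its successors, at the price of one step and, after a universal block, of one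
    switch. *)
Lemma spec_ex (I : Type) (f : I -> act) l c s ih out wt cl b T al q (P : I -> Prop) :
  At c s ih out wt cl -> nkind s = KEx -> s != Qy ->
  nd s (nth Blk (map Bit x) ih) (nth Blk wt.1 wt.2) (reads_cl cl) = map f l ->
  (forall i c', List.In i l -> AtA c' ih out wt cl (f i) ->
     run_spec x O c' true T al q (P i)) ->
  run_spec x O c b T.+1 ((b != true) + al) q (exists i, List.In i l /\ P i).
Proof.
move=> hc hk nq e h; have [e1 _ _] := hc.
have nq' : is_query_state (M := N) (cst c) = false by rewrite /is_query_state /= e1 (negbTE nq).
have hs c' : succ x O c c' <-> exists i, List.In i l /\ c' = apply_tr c (act_tr Blk (f i)).
  rewrite (succ_At c' hc nq (or_introl hk)) e; split=> [[a [/In_map [i [hi ->]] ->]]|[i [hi ->]]].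
    by exists i.
  by exists (f i); split=> //; apply/In_map; exists i.
split; last first.
  apply: path_bounds_step; first by rewrite /label nq' /= e1 hk.
  by move=> c' /hs [i [hi ->]]; have [] := h _ _ hi (At_apply (f i) hc).
rewrite accepts_exE ?nq' //=; last by rewrite e1.
split=> [[c' [/hs [i [hi ->]]]]|[i [hi pa]]].
  by rewrite (h _ _ hi (At_apply (f i) hc)).1; exists i.
exists (apply_tr c (act_tr Blk (f i))); split; first by apply/hs; exists i.
by rewrite (h _ _ hi (At_apply (f i) hc)).1.
Qed.

Lemma spec_un (I : Type) (f : I -> act) l c s ih out wt cl b T al q (P : I -> Prop) :
  At c s ih out wt cl -> nkind s = KUn -> s != Qy ->
  nd s (nth Blk (map Bit x) ih) (nth Blk wt.1 wt.2) (reads_cl cl) = map f l ->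
  (forall i c', List.In i l -> AtA c' ih out wt cl (f i) ->
     run_spec x O c' false T al q (P i)) ->
  run_spec x O c b T.+1 ((b != false) + al) q (forall i, List.In i l -> P i).
Proof.
move=> hc hk nq e h; have [e1 _ _] := hc.
have nq' : is_query_state (M := N) (cst c) = false by rewrite /is_query_state /= e1 (negbTE nq).
have hs c' : succ x O c c' <-> exists i, List.In i l /\ c' = apply_tr c (act_tr Blk (f i)).
  rewrite (succ_At c' hc nq (or_intror hk)) e; split=> [[a [/In_map [i [hi ->]] ->]]|[i [hi ->]]].
    by exists i.
  by exists (f i); split=> //; apply/In_map; exists i.
split; last first.
  apply: path_bounds_step; first by rewrite /label nq' /= e1 hk.
  by move=> c' /hs [i [hi ->]]; have [] := h _ _ hi (At_apply (f i) hc).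
rewrite accepts_unE ?nq' //=; last by rewrite e1.
split=> [g i hi|g c' /hs [i [hi ->]]].
  by rewrite -(h _ _ hi (At_apply (f i) hc)).1; apply/g/hs; exists i.
by rewrite (h _ _ hi (At_apply (f i) hc)).1; exact: g.
Qed.

Lemma spec_det a c s ih out wt cl T al q P :
  At c s ih out wt cl -> nkind s = KEx -> s != Qy ->
  nd s (nth Blk (map Bit x) ih) (nth Blk wt.1 wt.2) (reads_cl cl) = [:: a] ->
  (forall c', AtA c' ih out wt cl a -> run_spec x O c' true T al q P) ->
  run_spec x O c true T.+1 al q P.
Proof.
move=> hc hk nq e h.
have := spec_ex (I := unit) (f := fun=> a) (l := [:: tt]) true (P := fun=> P) hc hk nq e (fun _ c' _ => h c').
move/run_spec_le; apply=> //; split=> [[? []]|hp] //.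
by exists tt; split=> //; left.
Qed.

Lemma spec_guess (I : finType) (f : I -> act) c s ih out wt cl T al q (P : I -> Prop) :
  At c s ih out wt cl -> nkind s = KEx -> s != Qy ->
  nd s (nth Blk (map Bit x) ih) (nth Blk wt.1 wt.2) (reads_cl cl) = map f (enum I) ->
  (forall i c', AtA c' ih out wt cl (f i) -> run_spec x O c' true T al q (P i)) ->
  run_spec x O c true T.+1 al q (exists i, P i).
Proof.
move=> hc hk nq e h.
have := spec_ex true hc hk nq e (fun i c' _ => h i c').
move/run_spec_le; apply=> //; split=> [[i []]|[i hi]]; first by exists i.
by exists i; split=> //; apply/In_mem; rewrite mem_enum.
Qed.

(** ** Emission and query *)

Definition ans (w : seq bool) (b : bool) := if b then O w else ~ O w.

Lemma decode_Bit (tp : seq gam) (out : seq bool) : nth Blk tp =1 nth Blk (map Bit out) ->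
  @decode N tp = out.
Proof.
elim: tp out => [|g tp IH] [|b out] h //=.
- by have := h 0.
- have := h 0 => /= ->.
  by case: pickP => // b /= /eqP.
- have /= -> := h 0; case: pickP => [b' /eqP [->]|/(_ b)]; last by rewrite eqxx.
  by congr cons; apply: IH => k; exact: h k.+1.
Qed.

Lemma halt_spec c b b' ih out wt cl : At c (Hl b) ih out wt cl ->
  run_spec x O c b' 0 0 0 b.
Proof.
move=> [e _ _]; have nq : is_query_state (M := N) (cst c) = false by rewrite /is_query_state /= e.
split.
  case: b e => e; split=> //; first by move=> _; apply: acc_acc; rewrite ?nq //= e.
  by move/accepts_rejE; rewrite nq /= e; case.
move=> [_|c' cs []]; first by rewrite /= /label nq /= e; case: b e.
by rewrite /succ /= e; case: b e.
Qed.

Lemma query_spec c ih out b cl l : At c Qy ih out (Ans b :: l, 0) cl ->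
  run_spec x O c true 2 0 1 (ans out b).
Proof.
move=> hc; have [e e2 h] := hc.
have q : is_query_state (M := N) (cst c) by rewrite /is_query_state /= e.
have ow : oracle_word c = out.
  by apply: decode_Bit => k; have [_ ->] := h ord0; rewrite fam0.
have hs c' : succ x O c c' <-> exists b', ans out b' /\ c' = set_state (M := N) c (An b').
  rewrite /succ /= e eqxx ow; split.
    by case=> -[h1 ->]; [exists true|exists false].
  by case=> -[] [h1 ->]; [left|right].
have h2 b' : run_spec x O (set_state (M := N) c (An b')) true 1 0 0 (b' == b).
  apply: (spec_det (a := Act (Hl (b' == b)) MS None (Ans b, MS) (fun k => (reads_cl cl k, MS)))).
  - by split; [reflexivity|exact: e2|exact: h].
  - by [].
  - by [].
  - by [].
  - by move=> c'; exact: halt_spec.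
split.
  rewrite accepts_queryE //; split=> [[c' [/hs [b' [hb ->]]]]|hb].
    by rewrite (h2 b').1 => /eqP <-.
  exists (set_state (M := N) c (An b)); split; first by apply/hs; exists b.
  by rewrite (h2 b).1.
by apply: path_bounds_query => // c' /hs [b' [_ ->]]; have [] := h2 b'.
Qed.

Lemma AtA_idle c ih out ws p cl s m o g m' :
  AtA c ih out (ws, p) cl (Act s m o (g, m') (fun k => (reads_cl cl k, MS))) ->
  At c s (mv m ih) (out ++ seq_of_opt o) (set_nth Blk ws p g, mv m' p) cl.
Proof.
move/At_teq; apply; first exact: teq_refl.
by move=> k; rewrite /= ffunE; case: (cl k) => l r; exact: teq_idle.
Qed.

Lemma emit_spec dir k b (j : 'I_emax.+1) c ih out ws p cl T al q P :
  let e := emw dir k (nth Blk ws p) in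
  j <= size e -> At c (Em dir k b j) ih out (ws, p) cl ->
  (forall c', At c' (Em dir k b (inord (size e))) ih (out ++ drop j e) (ws, p) cl ->
     run_spec x O c' true T al q P) ->
  run_spec x O c true (T + (size e - j)) al q P.
Proof.
move=> e; move E : (size e - j) => r; elim: r j c out E => [|r IH] j c out E lj hc h.
  have ej : nat_of_ord j = size e by apply/eqP; rewrite eqn_leq lj -subn_eq0 E eqxx.
  rewrite addn0; apply: h; rewrite -ej drop_oversize ?ej // cats0.
  by rewrite -{1}ej inord_val.
have lt : j < size e by rewrite -subn_gt0 E.
rewrite addnS; apply: (spec_det hc) => //=; first by rewrite lt.
move=> c' /AtA_idle hc'.
have hj : (inord j.+1 : 'I_emax.+1) = j.+1 :> nat.
  by rewrite inordK // ltnS (leq_trans lt) // size_emw.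
apply: (IH _ _ (out ++ [:: nth false e j]) _ _ (At_teq hc' (teq_idle _ _ _) (fun=> teq_refl _))).
- by rewrite hj subnS E.
- by rewrite hj.
move=> c2; rewrite hj -catA cat1s -drop_nth //; exact: h.
Qed.

Definition next_of dir k b (w : gam) : option (st * (gam * move)) :=
  match w with
  | Bd2 _ => Some (Em dir k b ord0, (w, if dir then MR else ML))
  | Blk => Some (Em false k b ord0, (w, ML))
  | Hd _ => Some (Qy, (Ans b, MS))
  | _ => None
  end.

Lemma letter_spec dir k b c ih out ws p cl T al q P s g m :
  next_of dir k b (nth Blk ws p) = Some (s, (g, m)) ->
  At c (Em dir k b ord0) ih out (ws, p) cl ->
  (forall c', At c' s ih (out ++ emw dir k (nth Blk ws p)) (set_nth Blk ws p g, mv m p) cl ->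
     run_spec x O c' true T al q P) ->
  run_spec x O c true (T + emax.+1) al q P.
Proof.
move=> hn hc h; set e := emw _ _ _ in h.
have sz : size e <= emax by exact: size_emw.
suff H : run_spec x O c true (T.+1 + (size e - 0)) al q P.
  by apply: run_spec_le H _ (leqnn _) (leqnn _) (iff_refl _); rewrite subn0 addSnnS leq_add2l ltnS.
apply: (emit_spec (j := ord0)) hc _ => // c' hc'.
rewrite drop0 in hc'.
apply: (spec_det (a := Act s MS None (g, m) (fun k => (reads_cl cl k, MS))) hc') => //.
  rewrite /= inordK ?ltnS // -/e ltnn.
  by move: hn; rewrite /next_of; case: (nth Blk ws p) => //; [case=> <- <- <- | move=> ? [<- <- <-] | move=> ? [<- <- <-]].
by move=> c2 /AtA_idle; rewrite /= cats0; exact: h.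
Qed.

(** The emission runs to the right end, writes the separator of [pair_enc] there, and returns to the
    left end, where the tag is added. The second part is reversed because it is written on the way
    back. *)
Definition oword k (y : seq Y) := flatten (map (em1 k) y) ++ [:: false; true] ++
  flatten (map (em2 k) (rev y)) ++ tag k.

Lemma em2_spec k b f ih cl y y2 out c :
  At c (Em false k b ord0) ih out (Hd f :: map Bd2 (y ++ y2), size y) cl ->
  run_spec x O c true ((size y).+1 * emax.+1 + 2) 0 1
    (ans (out ++ flatten (map (em2 k) (rev y)) ++ tag k) b).
Proof.
elim/last_ind: y y2 out c => [|y a IH] y2 out c hc.
  rewrite mul1n addnC.
  by apply: letter_spec hc _ => //= c' hc'; apply: query_spec hc'.
have en : nth Blk (Hd f :: map Bd2 (rcons y a ++ y2)) (size (rcons y a)) = Bd2 a.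
  by rewrite size_rcons /= map_cat map_rcons cat_rcons nth_cat size_map ltnn subnn.
rewrite size_rcons in hc en *; rewrite mulSn -addnA addnC.
apply: letter_spec hc _; first by rewrite en.
move=> c' hc'; rewrite rev_rcons /= catA catA; rewrite en /= in hc'.
rewrite -catA; apply: (IH (a :: y2)).
apply: At_teq hc' _ (fun=> teq_refl _).
rewrite -cat_rcons; have := teq_idle (Hd f :: map Bd2 (rcons y a ++ y2)) (size y).+1 (size y).
by rewrite en.
Qed.

Lemma em1_spec k b f ih cl y1 y out c :
  At c (Em true k b ord0) ih out (Hd f :: map Bd2 (y1 ++ y), (size y1).+1) cl ->
  run_spec x O c true ((size y).+1 * emax.+1 + ((size (y1 ++ y)).+1 * emax.+1 + 2)) 0 1
    (ans (out ++ flatten (map (em1 k) y) ++ [:: false; true] ++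
          flatten (map (em2 k) (rev (y1 ++ y))) ++ tag k) b).
Proof.
elim: y y1 out c => [|a y IH] y1 out c hc.
  have en : nth Blk (Hd f :: map Bd2 (y1 ++ [::])) (size y1).+1 = Blk.
    by rewrite cats0 nth_default //= size_map.
  rewrite mul1n addnC; apply: letter_spec hc _; first by rewrite en.
  move=> c' hc'; rewrite en /= in hc'; rewrite [flatten (map _ [::])]/= cat0s catA.
  rewrite cats0; apply: (em2_spec (y2 := [::]) (f := f)).
  apply: At_teq hc' _ (fun=> teq_refl _).
  have := teq_idle (Hd f :: map Bd2 (y1 ++ [::])) (size y1).+1 (size y1).
  by rewrite en.
have en : nth Blk (Hd f :: map Bd2 (y1 ++ a :: y)) (size y1).+1 = Bd2 a.
  by rewrite /= map_cat nth_cat size_map ltnn subnn.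
rewrite [size (a :: y)]/= mulSn -addnA addnC.
apply: letter_spec hc _; first by rewrite en.
move=> c' hc'; rewrite en /= in hc'; rewrite [flatten (map _ (a :: y))]/= -catA catA.
rewrite -cat_rcons; apply: IH.
apply: At_teq hc' _ (fun=> teq_refl _); rewrite size_rcons cat_rcons.
have := teq_idle (Hd f :: map Bd2 (y1 ++ a :: y)) (size y1).+1 (size y1).+2.
by rewrite en.
Qed.

Lemma switches_flip b b' s : switches b s <= (switches b' s).+1.
Proof. by case: s => //= c s; case: b b' c => [] [] [] /=; lia. Qed.

(** The presumed owner enters only the first comparison of labels, so changing it costs at most one
    switch. *)
Lemma run_spec_flip c b b' T al q P :
  run_spec x O c b T al q P -> run_spec (M := N) x O c b' T al.+1 q P.
Proof.
move=> [h1 h2]; split=> // cs /h2 [u1 u2 u3]; split=> //.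
by apply: leq_trans (switches_flip _ b _) _.
Qed.

(** What remains to be secured once both windows are fixed: all tests of [ut], and one test of [et]
    whenever it returns a list. *)
Definition Leaf f (y : seq Y) := forall f', let v := foldr stp v0 y in
  (forall kb, List.In kb (ut f f' v) -> ans (oword kb.1 y) kb.2) /\
  (if et f f' v is Some l then exists kb, List.In kb l /\ ans (oword kb.1 y) kb.2
   else True).

Definition bd (u : X * option bool) := Bd u.1 u.2.
Definition Tem n := n.+1 * emax.+1 + (n.+1 * emax.+1 + 2).

Lemma em_spec k b f ih cl y c :
  At c (Em true k b ord0) ih [::] (Hd f :: map Bd2 y, 1) cl ->
  run_spec x O c true (Tem (size y)) 0 1 (ans (oword k y) b).
Proof. by move=> hc; have := em1_spec (y1 := [::]) hc. Qed.

Definition choiceP f y (i : K * bool + F) :=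
  match i with
  | inl kb => ans (oword kb.1 y) kb.2
  | inr f' => exists kb, List.In kb (odflt [::] (et f f' (foldr stp v0 y))) /\
                         ans (oword kb.1 y) kb.2
  end.

Lemma choices_Leaf f y :
  (forall i, List.In i (choices f (foldr stp v0 y)) -> choiceP f y i) <-> Leaf f y.
Proof.
split=> h.
  move=> f' v; have hf : List.In f' (enum F) by apply/In_mem; rewrite mem_enum.
  split=> [kb hkb|].
    apply: (h (inl kb)); apply/In_flatten_map; exists f'; split=> //.
    by apply/In_cat; left; apply/In_map; exists kb.
  case E : (et f f' v) => [l|//].
  have := h (inr f'); rewrite /choiceP -/v E /=; apply.
  apply/In_flatten_map; exists f'; split=> //; apply/In_cat; right.
  by rewrite E; left.
move=> i /In_flatten_map [f' [_ /In_cat [/In_map [kb [hk ->]]|]]].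
  by have [h1 _] := h f'; exact: h1.
have [_] := h f'; case E : (et f f' _) => [l|//] h2 /= [<-|//].
by rewrite /= E.
Qed.

(** Moving leftwards, the sweep meets the letters in the order in which [foldr] consumes them. Its
    state is the automaton value of the part already paired, hence of both complete windows when
    [Hd] is reached. *)
Lemma sw_spec f ih cl l y c :
  At c (Sw (foldr stp v0 y)) ih [::] (Hd f :: map bd l ++ map Bd2 y, size l) cl ->
  run_spec x O c false (Tem (size l + size y) + 2 + size l) 1 1
    (forall l', size l' = size l -> Leaf f (zip l l' ++ y)).
Proof.
elim/last_ind: l y c => [|l [a z] IH] y c hc.
  apply: (run_spec_le (T := (Tem (size y)).+2) (a := 1) (q := 1) (P := Leaf f y)) => //; last first.
  - split=> [h [|//]//|h]; exact: (h [::]).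
  - by rewrite /= add0n addn0 addn2.
  suff H : run_spec x O c false (Tem (size y)).+2 ((false != false) + 1) 1
    (forall i, List.In i (choices f (foldr stp v0 y)) -> choiceP f y i).
    exact: run_spec_le H (leqnn _) (leqnn _) (leqnn _) (choices_Leaf f y).
  apply: (spec_un false hc) => //.
  move=> [kb|f'] c' hi /AtA_idle /= hc'; rewrite ?cats0 in hc'.
    by apply: run_spec_flip; apply: run_spec_le (em_spec hc') _ _ _ _ => //; lia.
  apply: (run_spec_flip (b := true)); apply: (spec_ex true hc') => //.
  by move=> kb c2 _ /AtA_idle /= hc2; rewrite ?cats0 in hc2; exact: em_spec hc2.
rewrite size_rcons.
apply: (run_spec_le (T := (Tem (size l + size ((a, z, a) :: y)) + 2 + size l).+1) (a := 1) (q := 1)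
   (P := forall x', List.In x' (enum X) -> forall l', size l' = size l -> Leaf f (zip l l' ++ ((a, z), x') :: y))) => //.
- apply: (spec_un false hc) => //.
    by rewrite size_rcons /= map_rcons cat_rcons nth_cat size_map ltnn subnn /=.
  move=> x' c' _ /AtA_idle /= hc'; apply: IH; rewrite ?cats0 in hc'.
  apply: At_teq hc' _ (fun=> teq_refl _); rewrite size_rcons /=.
  rewrite map_rcons cat_rcons -{1}(size_map bd) set_nth_cat_size /=; exact: teq_refl.
- by rewrite /= addSn !addnS.
- split=> [h l'|h x' _ l' sl].
    case/lastP: l' => [|l' x']; rewrite ?size_rcons // => -[sl].
    rewrite zip_rcons // cat_rcons; apply: h => //.
    by apply/In_mem; rewrite mem_enum.
  have := h (rcons l' x'); rewrite size_rcons zip_rcons // cat_rcons; apply.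
  by rewrite sl.
Qed.

(** ** Clocked guessing *)

Let n := size x.
Definition marks := Mk (Some false) :: rcons (nseq n (Mk None)) (Mk (Some true)).

Lemma nth_marks p : p <= n.+1 ->
  nth Blk marks p = Mk (if p == 0 then Some false else if p == n.+1 then Some true else None).
Proof.
case: p => //= p; rewrite ltnS eqSS => lp; rewrite nth_rcons size_nseq.
by case: ltngtP lp => //= lp _; rewrite nth_nseq lp.
Qed.

Definition rest (b : bool) p := if b then n.+1 - p else p.

Lemma atend_marks b p : p <= n.+1 -> atend b (nth Blk marks p) = (rest b p == 0).
Proof.
have eqMk u v : (Mk u == Mk v) = (u == v) by apply/eqP/eqP => [[]|->].
move=> lp; rewrite nth_marks // /rest /atend eqMk; case: b => /=; last first.
  by case: p lp => // p _; rewrite [_ == 0]/=; case: ifP.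
case: p lp => // p lp; rewrite [p.+1 == 0]/= subn_eq0.
by case: (p.+1 =P n.+1) => [->|ne]; rewrite ?leqnn //; apply/esym/negbTE; lia.
Qed.

(** The number of ticks left: in base [n.+2], each digit is the distance of a head from the mark it
    is travelling to. *)
Definition ckval (ds : 'I_d -> bool) (ps : 'I_d -> nat) :=
  \sum_(k < d) rest (ds k) (ps k) * n.+2 ^ k.

Lemma sum_digits m : (\sum_(k < m) n.+1 * n.+2 ^ k).+1 = n.+2 ^ m.
Proof. by rewrite -big_distrr /= -(predn_exp n.+2) prednK // expn_gt0. Qed.

Lemma ck_expired (ds : {ffun 'I_d -> bool}) ps : (forall k, ps k <= n.+1) ->
  firstfree ds (reads_cl (fun k => (marks, ps k))) = None -> ckval ds ps = 0.
Proof.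
move=> lp; rewrite /firstfree; case: pickP => // h _.
suff z k : rest (ds k) (ps k) = 0 by rewrite /ckval big1 // => k _; rewrite z.
elim/ltn_ind: {k}(val k) {-2}k (erefl (val k)) => m IH k ek.
move: (h k); rewrite ffunE /= atend_marks //.
case: eqP => //= _ /negbT /forallPn [k']; rewrite negb_imply ffunE atend_marks ?lp // => /andP [lt].
have lt' : val k' < m by rewrite -ek.
by have /= -> := IH _ lt' k' erefl.
Qed.

(** Below the digit [j] that moves, all distances are 0, and reversing the direction turns them into
    [n.+1] without moving a head. As [1 + sum_(k < j) n.+1 * n.+2 ^ k = n.+2 ^ j], this and the step
    of digit [j] lower the value by exactly 1. *)
Lemma ck_tick (ds : {ffun 'I_d -> bool}) ps j : (forall k, ps k <= n.+1) ->
  let rc := reads_cl (fun k => (marks, ps k)) in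
  firstfree ds rc = Some j ->
  let ps' k := mv (ckmove ds rc j k).2 (ps k) in
  (forall k, ps' k <= n.+1) /\ (ckval (flip ds j) ps').+1 = ckval ds ps.
Proof.
move=> lp rc; rewrite /firstfree; case: pickP => // j' /andP [nj /forallP lj] [<-] {j}.
pose ps' k := mv (ckmove ds rc j' k).2 (ps k).
change ((forall k, ps' k <= n.+1) /\ (ckval (flip ds j') ps').+1 = ckval ds ps).
rewrite ffunE atend_marks ?lp // in nj.
have zj (k : 'I_d) : k < j' -> rest (ds k) (ps k) = 0.
  by move=> lt; apply/eqP; move: (lj k); rewrite lt ffunE atend_marks ?lp.
have ej : (rest (ds j') (ps' j')).+1 = rest (ds j') (ps j') /\ ps' j' <= n.+1.
  rewrite /ps' /= eqxx; move: nj (lp j'); rewrite /rest; case: (ds j') => /=; lia.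
have hp (k : 'I_d) : k != j' -> ps' k = ps k by move=> /negbTE nk; rewrite /ps' /= nk.
split=> [k|].
  by have [->|/hp ->] := eqVneq k j'; [exact: ej.2|exact: lp].
rewrite /ckval (bigID (fun k : 'I_d => k < j')) [in RHS](bigID (fun k : 'I_d => k < j')) /=.
rewrite [X in _ = X + _]big1 ?add0n; last by move=> k lt; rewrite zj.
have -> : \sum_(k < d | k < j') rest (flip ds j' k) (ps' k) * n.+2 ^ k
        = \sum_(k < j') n.+1 * n.+2 ^ k.
  rewrite (big_ord_widen d (fun k => n.+1 * n.+2 ^ k)) 1?ltnW //.
  apply: eq_bigr => k lt; congr (_ * _); rewrite ffunE lt hp; last by rewrite -val_eqE /= ltn_eqF.
  by have := lp k; have := zj k lt; rewrite /rest; case: (ds k) => /=; lia.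
rewrite -addSn sum_digits.
rewrite (bigD1 j') ?ltnn //= [in RHS](bigD1 j') ?ltnn //= addnA ffunE ltnn -ej.1 mulSn.
congr (_ + _); apply: eq_bigr => k /andP [nlt nk].
by rewrite ffunE (negbTE nlt) hp.
Qed.

Definition Tsw m := Tem m + 2 + m.

Lemma tk_spec f ih v (ds : {ffun 'I_d -> bool}) ps l c : (forall k, ps k <= n.+1) ->
  ckval ds ps = v ->
  At c (Tk ds) ih [::] (Hd f :: map bd l, (size l).+1) (fun k => (marks, ps k)) ->
  run_spec x O c true (v + (Tsw (size l + v)).+1) 2 1
    (exists w, size w = v /\ forall l', size l' = size l + v ->
       Leaf f (zip (l ++ zip w (nseq v None)) l')).
Proof.
elim: v ds ps l c => [|v IH] ds ps l c lp ev hc.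
  case E : (firstfree ds (reads_cl (fun k => (marks, ps k)))) => [j|].
    by have [_] := ck_tick lp E; rewrite ev.
  suff H : run_spec x O c true (Tsw (size l)).+1 2 1
             (forall l', size l' = size l -> Leaf f (zip l l' ++ [::])).
    apply: run_spec_le H _ _ _ _ => //; first by rewrite addn0.
    split=> [h|[w [/size0nil -> h]] l' sl].
      by exists [::]; split=> // l'; rewrite addn0 /= cats0 => /h; rewrite cats0.
    by have := h l'; rewrite /= addn0 !cats0 => /(_ sl).
  apply: (spec_det hc) => //; first by rewrite /= E.
  move=> c' /AtA_idle /= hc'; apply: (run_spec_flip (b := false)).
  have := sw_spec (f := f) (ih := ih) (cl := (fun k => (marks, ps k))) (l := l) (y := [::]) (c := c').
  rewrite addn0; apply; apply: At_teq hc' _ (fun=> teq_refl _).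
  have := teq_idle (Hd f :: map bd l) (size l).+1 (size l).
  by rewrite cats0.
case E : (firstfree ds (reads_cl (fun k => (marks, ps k)))) => [j|]; last first.
  by rewrite ck_expired in ev.
have [lp' ev'] := ck_tick lp E; rewrite ev in ev'; case: ev' => ev'.
suff H : run_spec x O c true (v + (Tsw (size l + v.+1)).+1).+1 2 1
   (exists a, exists w, size w = v /\ forall l', size l' = size (rcons l (a, None)) + v ->
       Leaf f (zip (rcons l (a, None) ++ zip w (nseq v None)) l')).
  apply: run_spec_le H _ _ _ _ => //.
  split=> [[a [w [sw h]]]|[[|a w] [//= [sw] h]]].
    exists (a :: w); split=> [|l' sl]; first by rewrite /= sw.
    by rewrite /= -cat_rcons; apply: h; rewrite size_rcons addSnnS.
  exists a, w; split=> // l' sl; rewrite cat_rcons; apply: h.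
  by rewrite sl size_rcons addSnnS.
apply: (spec_guess (f := fun a => Act (Tk (flip ds j)) MS None (Bd a None, MR)
   (ckmove ds (reads_cl (fun k => (marks, ps k))) j)) hc) => //; first by rewrite /= E.
move=> a c' hc'.
have -> : size l + v.+1 = size (rcons l (a, None)) + v by rewrite size_rcons addSnnS.
apply: IH lp' ev' _; apply: At_teq hc' _ _.
  rewrite /= size_rcons map_rcons -(size_map bd) set_nth_size; exact: teq_refl.
by move=> k; rewrite /= ffunE; exact: teq_idle.
Qed.

Definition glen := n + n.+2 ^ d.
Definition Tall := glen + (Tsw glen).+2.

Lemma s1_spec f x1 x2 l c : x = x1 ++ x2 -> size l = size x1 ->
  At c S1 (size x1) [::] (Hd f :: map bd l, (size l).+1)
     (fun=> (Mk (Some false) :: nseq (size x1) (Mk None), (size x1).+1)) ->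
  run_spec x O c true (size x2 + n.+2 ^ d + (Tsw glen).+1) 2 1
    (exists w, size w = size x2 + n.+2 ^ d /\ forall l', size l' = glen ->
       Leaf f (zip (l ++ zip w (map Some x2 ++ nseq (n.+2 ^ d) None)) l')).
Proof.
elim: x2 x1 l c => [|b x2 IH] x1 l c ex sl hc.
  have ex1 : size x1 = n by rewrite /n ex cats0.
  have eB : n.+2 ^ d = (\sum_(k < d) n.+1 * n.+2 ^ k).+1 by rewrite sum_digits.
  set v := (\sum_(k < d) n.+1 * n.+2 ^ k) in eB.
  have gl : glen = (size l).+1 + v by rewrite /glen eB sl ex1 addnS.
  suff H : run_spec x O c true (v + (Tsw glen).+1).+1 2 1
   (exists a, exists w, size w = v /\ forall l', size l' = glen ->
       Leaf f (zip (rcons l (a, None) ++ zip w (nseq v None)) l')).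
    apply: run_spec_le H _ _ _ _ => //; first by rewrite eB.
    rewrite eB; split=> [[a [w [sw h]]]|[[|a w] [//= [sw] h]]].
      exists (a :: w); split=> [|l' sl']; first by rewrite /= sw.
      by rewrite /= -cat_rcons; exact: h.
    exists a, w; split=> // l' sl'; rewrite cat_rcons; exact: h.
  apply: (spec_guess hc) => //=.
    by rewrite nth_default ?size_map // ex1.
  move=> a c' hc'; rewrite gl -(size_rcons l (a, None)).
  (* All clock heads stand on the right mark and travel left, so the clock shows its maximum
     [n.+2 ^ d - 1]. The letter written at the step just made brings the padding to [n.+2 ^ d]
     letters. *)
  apply: (tk_spec (ps := fun=> n.+1) (ds := [ffun=> false])) => //.
    by apply: eq_bigr => k _; rewrite ffunE.
  apply: At_teq hc' _ _ => /=.
    rewrite size_rcons map_rcons -(size_map bd) set_nth_size; exact: teq_refl.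
  move=> k; rewrite ex1 /= -{2}(size_nseq n (Mk None)) set_nth_size.
  exact: teq_refl.
suff H : run_spec x O c true (size x2 + n.+2 ^ d + (Tsw glen).+1).+1 2 1
   (exists a, exists w, size w = size x2 + n.+2 ^ d /\ forall l', size l' = glen ->
       Leaf f (zip (rcons l (a, Some b) ++ zip w (map Some x2 ++ nseq (n.+2 ^ d) None)) l')).
  apply: run_spec_le H _ _ _ _ => //.
  split=> [[a [w [sw h]]]|[[|a w] [//= [sw] h]]].
    exists (a :: w); split=> [|l' sl']; first by rewrite /= sw.
    by rewrite /= -cat_rcons; exact: h.
  exists a, w; split=> // l' sl'; rewrite cat_rcons; exact: h.
apply: (spec_guess (f := fun a => Act S1 MR None (Bd a (Some b), MR) (fun=> (Mk None, MR))) hc) => //=.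
  by rewrite ex map_cat nth_cat size_map ltnn subnn.
move=> a c' hc'; apply: (IH (rcons x1 b)).
- by rewrite cat_rcons.
- by rewrite !size_rcons sl.
rewrite size_rcons; apply: At_teq hc' _ _ => /=.
- rewrite size_rcons map_rcons -(size_map bd) set_nth_size; exact: teq_refl.
move=> k; rewrite -{2}(size_nseq (size x1) (Mk None)) set_nth_size.
have -> m : rcons (nseq m (Mk None)) (Mk None) = nseq m.+1 (Mk None) by elim: m => //= m ->.
exact: teq_refl.
Qed.

Lemma init_spec :
  run_spec x O (init_cfg N) true Tall 2 1
    (exists f w, size w = glen /\ forall w', size w' = glen ->
       Leaf f (zip (zip w (map Some x ++ nseq (n.+2 ^ d) None)) w')).
Proof.
rewrite /Tall addnS.
have hc : At (init_cfg N) S0 0 [::] ([::], 0) (fun=> ([::], 0)).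
  split=> // i; rewrite /= ffunE; elim/fam_ind: i => [||k]; rewrite ?fam0 ?famw ?famc //.
apply: (spec_guess (f := fun f => Act S1 MS None (Hd f, MR) (fun=> (Mk (Some false), MR))) hc) => //.
move=> f c' hc'.
exact: (@s1_spec f [::] x [::] c' erefl erefl hc').
Qed.

End Steps.
End Verifier.

(** * Polynomials with natural coefficients *)

Section NatPoly.
Import GRing.Theory.
Local Open Scope ring_scope.

Lemma polynE (p : {poly nat}) n : polyn p n = p.[n].
Proof.
rewrite horner_coef /polyn; apply: eq_bigr => i _.
by rewrite natrXE natrME.
Qed.

Lemma hornerD_nat (p q : {poly nat}) n : (p + q).[n] = (p.[n] + q.[n])%N.
Proof. by rewrite hornerD natrDE. Qed.
Lemma hornerM_nat (p q : {poly nat}) n : (p * q).[n] = (p.[n] * q.[n])%N.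
Proof. by rewrite hornerM natrME. Qed.
Lemma hornerXn_nat (p : {poly nat}) d n : (p ^+ d).[n] = (p.[n] ^ d)%N.
Proof. by rewrite horner_exp natrXE. Qed.
Definition horner_nat := (hornerD_nat, hornerM_nat, hornerXn_nat, hornerC, hornerX).

Definition glen_poly d : {poly nat} := 'X + ('X + 2%N%:P) ^+ d.

Lemma glen_polyE d (x : seq bool) : (glen_poly d).[size x] = glen d x.
Proof. by rewrite /glen_poly !horner_nat /glen addn2. Qed.

End NatPoly.

(** * Functions computed by finite automata *)

Section Regular.
Variable Y : Type.

(** The automaton reads from right to left, as the universal sweep does. Only its state is stored by
    the machine, so the type of the output need not be finite. *)
Definition regular (T : Type) (f : seq Y -> T) :=
  exists (V : finType) (v0 : V) (stp : Y -> V -> V) (out : V -> T),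
    forall s, f s = out (foldr stp v0 s).

Lemma regular_pair T1 T2 T (f1 : seq Y -> T1) (f2 : seq Y -> T2) (h : T1 -> T2 -> T) :
  regular f1 -> regular f2 -> regular (fun s => h (f1 s) (f2 s)).
Proof.
move=> [V1 [v1 [s1 [o1 h1]]]] [V2 [v2 [s2 [o2 h2]]]].
exists (V1 * V2)%type, (v1, v2), (fun y v => (s1 y v.1, s2 y v.2)).
exists (fun v => h (o1 v.1) (o2 v.2)) => s; rewrite h1 h2.
by have -> : foldr (fun y v => (s1 y v.1, s2 y v.2)) (v1, v2) s = (foldr s1 v1 s, foldr s2 v2 s)
  by elim: s => //= y s ->.
Qed.

(** It is applied to tuples: the function of interest is joined with the auxiliary values of its
    recursion until the tuple at [y :: s] depends only on [y] and the tuple at [s]. *)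
Lemma regular_fin (V : finType) T (f : seq Y -> V) (stp : Y -> V -> V) (out : V -> T) :
  (forall y s, f (y :: s) = stp y (f s)) -> regular (fun s => out (f s)).
Proof.
move=> h; exists V, (f [::]), stp, out => s; congr out.
by elim: s => //= y s IH; rewrite h IH.
Qed.

End Regular.

Lemma regular_map Y Y' T (u : Y' -> Y) (f : seq Y -> T) :
  regular f -> regular (fun s => f (map u s)).
Proof.
move=> [V [v [s [o h]]]]; exists V, v, (fun y => s (u y)), o => l.
by rewrite h foldr_map.
Qed.

Definition padded d (x : seq bool) := map Some x ++ nseq ((size x).+2 ^ d) None.

(** The quantifiers over [f] and [w], over [w'] and [f'], and over [kb] become the three stages of
    the machine. Everything decided about the windows passes through [info], and each branch that
    reaches the oracle asks about a single [oword]. *)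
Theorem verifier (F X K : finType) (T : Type) (d : nat)
    (info : seq (X * option bool * X) -> T)
    (ut : F -> F -> T -> seq (K * bool)) (et : F -> F -> T -> option (seq (K * bool)))
    (em1 em2 : K -> X * option bool * X -> seq bool) (tag : K -> seq bool) :
  regular info ->
  exists N : ATM, SigmaP4_single_query_oracle N /\
    forall x O, accepts_with N x O <->
      exists f w, size w = glen d x /\ forall w', size w' = glen d x ->
      forall f', let y := zip (zip w (padded d x)) w' in
        (forall kb, List.In kb (ut f f' (info y)) -> ans O (oword em1 em2 tag kb.1 y) kb.2) /\
        (if et f f' (info y) is Some l
         then exists kb, List.In kb l /\ ans O (oword em1 em2 tag kb.1 y) kb.2 else True).
Proof.
case=> V [v0 [stp [out hinfo]]].
pose ut' f f' v := ut f f' (out v); pose et' f f' v := et f f' (out v).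
pose N := verifier_machine d v0 stp ut' et' em1 em2 tag.
have hs x O := init_spec d v0 stp ut' et' em1 em2 tag x O.
exists N; split.
  split=> //; split.
    pose E := (emax F em1 em2 tag).+1.
    have [g hg] : exists g : {poly nat}, forall x : seq bool, g.[size x]%R = glen d x.
      by exists (glen_poly d) => x; exact: glen_polyE.
    exists (polyseq (g + (g + 1%N%:P) * E%:P + ((g + 1%N%:P) * E%:P + 2%N%:P) + 2%N%:P + g + 2%N%:P)%R).
    move=> x O cs /(hs x O).2 [h _ _]; apply: leq_trans h _.
    rewrite polynE !horner_nat hg /Tall /Tsw /Tem -/E; lia.
  split=> x O cs /(hs x O).2 [_ h1 h2] //.
  (* The initial state is existential, so no switch is counted at the first label. *)
  suff -> : nblocks (pmap (label (M:=N)) (init_cfg N :: cs)) = (switches true (pmap (label (M:=N)) (init_cfg N :: cs))).+1.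
    by apply: leq_trans (_ : 3 <= 4).
  by rewrite /= /label.
move=> x O; rewrite /accepts_with (hs x O).1.
by split=> -[f [w [sw h]]]; exists f, w; split=> // w' sw' f'; have /= := h w' sw' f'; rewrite hinfo.
Qed.

(** * Addresses *)

(* An address is a bit word whose last letter selects a mode: in unary mode   *)
(* (last letter [false]) the index of the first [true] is the position, so    *)
(* that position [i] can be matched with the [i]-th input letter; in binary   *)
(* mode the other letters count, least significant bit first.                 *)
Fixpoint bval (w : seq bool) : nat :=
  if w is b :: w' then if w' is [::] then 0 else b + 2 * bval w' else 0.

Definition pos (w : seq bool) :=
  if last false w then (size w).-1 + bval w else find id w.

Definition npos L := L.-1 + 2 ^ L.-1.

(* The functions below recognise, on a word of pairs, that the second address *)
(* is the successor of the first one.                                         *)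
Fixpoint both_false (l : seq (bool * bool)) :=
  if l is a :: l' then (a == (false, false)) && (nilp l' || both_false l') else false.
Definition mode_switch (l : seq (bool * bool)) :=
  if l is a :: l' then nilp l' && (a == (false, true)) else false.
Fixpoint same_binary (l : seq (bool * bool)) :=
  if l is a :: l' then
    if nilp l' then a == (true, true) else (a.1 == a.2) && same_binary l'
  else false.
Fixpoint succ_binary (l : seq (bool * bool)) :=
  if l is a :: l' then
    (a == (false, true)) && same_binary l' || (a == (true, false)) && succ_binary l'
  else false.
Definition one_ahead (l : seq (bool * bool)) :=
  if l is a :: l' then (a == (false, true)) && both_false l' else false.
Fixpoint succ_unary (l : seq (bool * bool)) :=
  if l is a :: l' then
    (a == (true, false)) && (one_ahead l' || mode_switch l') || (a == (false, false)) && succ_unary l'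
  else false.
Definition adj l := succ_binary l || succ_unary l.

Lemma adj_regular : regular adj.
Proof.
pose f l := (nilp l, both_false l, same_binary l, succ_binary l, one_ahead l, mode_switch l, succ_unary l).
apply: (@regular_fin _ _ _ f (fun a v =>
  let: (n, z, e, i, u, s, h) := v in
  (false, (a == (false, false)) && (n || z),
   if n then a == (true, true) else (a.1 == a.2) && e,
   (a == (false, true)) && e || (a == (true, false)) && i,
   (a == (false, true)) && z, n && (a == (false, true)),
   (a == (true, false)) && (u || s) || (a == (false, false)) && h))
  (fun v => v.1.1.1.2 || v.2)).
by [].
Qed.

Lemma both_false_zip w w' : size w = size w' -> both_false (zip w w') ->
  exists m, w = nseq m.+1 false /\ w' = nseq m.+1 false.
Proof.
elim: w w' => [|b w IH] [|b' w'] //= [sz] /andP [/eqP [-> ->]].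
case: w w' IH sz => [|c w] [|c' w'] //= IH sz h; first by exists 0.
by have [m [-> ->]] := IH (c' :: w') sz h; exists m.+1.
Qed.

Lemma same_binary_zip w w' : size w = size w' -> same_binary (zip w w') -> w = w' /\ last false w.
Proof.
elim: w w' => [|b w IH] [|b' w'] //= [sz].
case: w w' IH sz => [|c w] [|c' w'] IH // sz; first by move=> /= /eqP [-> ->].
rewrite [nilp _]/= => /andP [/eqP /= -> h].
by have [[<- <-] l] := IH _ sz h.
Qed.

Lemma succ_binary_zip w w' : size w = size w' -> succ_binary (zip w w') ->
  [/\ last false w, last false w' & bval w' = (bval w).+1].
Proof.
elim: w w' => [|b w IH] [|b' w'] // [sz] /=.
case/orP => /andP [/eqP [-> ->] h].
  by have [e l] := same_binary_zip sz h; case: w w' e l {IH sz h} => [|c w] w' // <- /= l; split=> //; lia.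
have [l l' e] := IH _ sz h.
by case: w w' l l' e {IH h sz} => [|c w] [|c' w'] //= l l' ->; split=> //; lia.
Qed.

Lemma succ_unary_zip w w' : size w = size w' -> succ_unary (zip w w') ->
  last false w = false /\
  (last false w' = false /\ find id w' = (find id w).+1 \/
   [/\ last false w', (find id w).+2 = size w & bval w' = 0]).
Proof.
elim: w w' => [|b w IH] [|b' w'] // [sz] /=.
case/orP => /andP [/eqP [-> ->] h]; last first.
  have [l h2] := IH _ sz h.
  case: w w' sz l h2 h {IH} => [|c w] [|c' w'] // sz l h2 _.
  split=> //; case: h2 => [[l' e]|[l' e1 e2]]; [left|right]; split=> //; by rewrite ?e -?e1 ?e2.
case/orP: h.
  case: w w' sz {IH} => [|c w] [|c' w'] //= [sz] /andP [/eqP [-> ->] /(both_false_zip sz) [m [-> ->]]].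
  by split; [elim: m | left; split=> //; elim: m].
case: w w' sz {IH} => [|c w] [|c' w'] //= [sz] /andP [].
case: w w' sz => [|? ?] [|? ?] // _ _ /eqP [-> ->].
by split=> //; right.
Qed.

(** Sound for arbitrary words of equal length; the converse is established only for the
    representatives [address]. *)
Lemma adj_pos w w' : size w = size w' -> adj (zip w w') -> pos w' = (pos w).+1.
Proof.
move=> sz /orP [/(succ_binary_zip sz) [l l' e]|/(succ_unary_zip sz) [l h]]; rewrite /pos.
  by rewrite l l' e sz addnS.
rewrite l; case: h => [[-> ->] //|[-> e ->]].
by rewrite -sz -e addn0.
Qed.

Fixpoint bits_of k u : seq bool := if k is k'.+1 then odd u :: bits_of k' u./2 else [::].

Lemma size_bits_of k u : size (bits_of k u) = k.
Proof. by elim: k u => //= k IH u; rewrite IH. Qed.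

(** The canonical word at position [v]. A choice is necessary since unary words that differ after
    their first [true] share a position. *)
Definition address L v : seq bool :=
  if v < L.-1 then nseq v false ++ true :: nseq (L - v.+1) false
  else rcons (bits_of L.-1 (v - L.-1)) true.

Lemma size_address L v : 0 < L -> size (address L v) = L.
Proof.
rewrite /address => L0; case: ifP => h; last by rewrite size_rcons size_bits_of prednK.
by rewrite size_cat /= !size_nseq; lia.
Qed.

Lemma both_false_nseq m : both_false (zip (nseq m.+1 false) (nseq m.+1 false)).
Proof. by elim: m. Qed.

Lemma same_binary_id w : same_binary (zip (rcons w true) (rcons w true)).
Proof. by elim: w => //= b w IH; rewrite eqxx IH; case: (w). Qed.

Lemma succ_binary_bits_of k u : u.+1 < 2 ^ k ->
  succ_binary (zip (rcons (bits_of k u) true) (rcons (bits_of k u.+1) true)).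
Proof.
elim: k u => [|k IH] u; first by rewrite expn0.
rewrite expnS => h; rewrite [bits_of _ _]/= [bits_of _ u.+1]/= !rcons_cons [zip _ _]/=.
rewrite [succ_binary _]/=; case: (boolP (odd u)) => o /=.
  rewrite uphalf_half o add1n; apply: IH.
  by have := odd_double_half u; rewrite o; lia.
by rewrite uphalf_half (negbTE o) add0n same_binary_id.
Qed.

Lemma succ_unary_onehot v r :
  succ_unary (zip (nseq v false ++ true :: nseq r.+2 false) (nseq v.+1 false ++ true :: nseq r.+1 false)).
Proof. by elim: v => [|v IH] /=; [have /= -> := both_false_nseq r | exact: IH]. Qed.

Lemma succ_unary_mode v : succ_unary (zip (nseq v false ++ [:: true; false]) (nseq v.+1 false ++ [:: true])).
Proof. by elim: v. Qed.

Lemma bits_of0 k : bits_of k 0 = nseq k false.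
Proof. by elim: k => //= k ->. Qed.

(** Three cases: a shift of the single [true], the passage from the last unary word to binary zero,
    and a binary increment. *)
Lemma adj_address L v : 1 < L -> v.+1 < npos L ->
  adj (zip (address L v) (address L v.+1)).
Proof.
rewrite /adj /address /npos => L1 hv; case: (ltnP v.+1 L.-1) => h1.
  rewrite (ltn_trans _ h1) //; apply/orP; right.
  have -> : L - v.+1 = (L - v.+3).+2 by lia.
  have -> : L - v.+2 = (L - v.+3).+1 by lia.
  exact: succ_unary_onehot.
case: (ltnP v L.-1) => h2; apply/orP.
  right; have ev : L.-1 = v.+1 by lia.
  have -> : L - v.+1 = 1 by lia.
  rewrite ev subnn bits_of0 -cats1; exact: succ_unary_mode.
left; have -> : v.+1 - L.-1 = (v - L.-1).+1 by lia.
by apply: succ_binary_bits_of; lia.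
Qed.

Lemma pos_address L v : 1 < L -> v < npos L -> pos (address L v) = v.
Proof.
move=> L1; elim: v => [|v IH] h.
  rewrite /address /pos; have -> : 0 < L.-1 by lia.
  have -> : L - 1 = (L - 2).+1 by lia.
  suff -> : last false (nseq 0 false ++ true :: nseq (L - 2).+1 false) = false by [].
  by rewrite /=; elim: (L - 2).
rewrite -{2}(IH (ltnW h)); apply: adj_pos; first by rewrite !size_address //; lia.
exact: adj_address.
Qed.

Lemma bits_of_max k : bits_of k (2 ^ k).-1 = nseq k true.
Proof.
elim: k => //= k <-.
have h : 0 < 2 ^ k by rewrite expn_gt0.
have -> : (2 ^ k.+1).-1 = true + (2 ^ k).-1.*2 by rewrite expnS; lia.
by rewrite half_bit_double /= oddD odd_double.
Qed.

Lemma address_last L : 1 < L -> address L (npos L).-1 = nseq L true.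
Proof.
move=> L1; rewrite /address /npos; have h : 0 < 2 ^ L.-1 by rewrite expn_gt0.
rewrite ifF; last by lia.
have -> : (L.-1 + 2 ^ L.-1).-1 - L.-1 = (2 ^ L.-1).-1 by lia.
rewrite bits_of_max; have {2}-> : L = L.-1.+1 by lia.
by elim: (L.-1) => //= m ->.
Qed.

Lemma pos_last L : 1 < L -> pos (nseq L true) = (npos L).-1.
Proof.
move=> L1; rewrite -address_last // pos_address //.
have h : 0 < 2 ^ L.-1 by rewrite expn_gt0.
by rewrite /npos; lia.
Qed.

Definition firstw (w : seq bool) := head false w && ~~ last false w.

Lemma firstw_pos w : 1 < size w -> firstw w = (pos w == 0).
Proof.
case: w => [|b [|c w]] // _; rewrite /firstw /pos; case: (last _ _); rewrite ?andbF ?andbT //.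
by case: b.
Qed.

Lemma firstw_regular : regular firstw.
Proof.
pose f (l : seq bool) := (nilp l, head false l, last false l).
apply: (@regular_fin _ _ _ f (fun a v => let: (n, h, l) := v in (false, a, if n then a else l))
  (fun v => v.1.2 && ~~ v.2)).
by move=> y [].
Qed.

Lemma all_regular (Y : Type) (p : Y -> bool) : regular (all p).
Proof. exact: (@regular_fin _ _ _ (all p) (fun a v => p a && v) id). Qed.

Lemma all_id_nseq (w : seq bool) : all id w -> w = nseq (size w) true.
Proof. by elim: w => //= -[] w IH //= /IH <-. Qed.

Fixpoint inpu (l : seq (bool * option bool)) :=
  if l is a :: l' then if a.1 then a.2 else inpu l' else None.
Definition inpw l := if last false (unzip1 l) then None else inpu l.

Lemma inpw_regular : regular inpw.
Proof.
pose f (l : seq (bool * option bool)) := (nilp l, last false (unzip1 l), inpu l).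
apply: (@regular_fin _ _ _ f (fun a v => let: (n, l, i) := v in
  (false, if n then a.1 else l, if a.1 then a.2 else i))
  (fun v => if v.1.2 then None else v.2)).
by move=> y [].
Qed.

(** In binary mode the position is at least [(size w).-1], where [z] is required to be blank; in
    unary mode the first [true] of [w] stands above the wanted letter. *)
Lemma inpw_pos w z : size w = size z ->
  (forall j, size w <= j.+1 -> nth None z j = None) ->
  inpw (zip w z) = nth None z (pos w).
Proof.
move=> sz hz; rewrite /inpw unzip1_zip ?sz // /pos; case: ifP => _.
  by rewrite hz //; lia.
by elim: w z sz {hz} => [|[] w IH] [|a z] //= [sz]; rewrite IH.
Qed.

Fixpoint onehot (w : seq bool) :=
  if w is b :: w' then if b then all negb w' else onehot w' else false.
Definition canonw w := last false w || onehot w.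

Lemma canonw_regular : regular canonw.
Proof.
pose f l := (nilp l, last false l, all negb l, onehot l).
apply: (@regular_fin _ _ _ f (fun a v => let: (n, l, z, o) := v in
  (false, if n then a else l, ~~ a && z, if a then z else o))
  (fun v => v.1.1.2 || v.2)).
by move=> y [].
Qed.

Lemma all_negb_nseq w : all negb w -> w = nseq (size w) false.
Proof. by elim: w => //= -[] w IH //= /IH <-. Qed.

Lemma onehotE w : onehot w ->
  w = nseq (find id w) false ++ true :: nseq (size w - (find id w).+1) false.
Proof.
elim: w => //= -[] w IH /=; first by move/all_negb_nseq => {1}->; rewrite subn1.
by rewrite subSS => /IH {1}->.
Qed.

Lemma binE_word w : last false w -> w = rcons (bits_of (size w).-1 (bval w)) true.
Proof.
elim: w => //= b [|c w] IH; first by case: b IH.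
move=> /IH {1}->; rewrite [size _]/= [bits_of _.+1 _]/=.
by rewrite mul2n half_bit_double oddD odd_double addbF oddb.
Qed.

Lemma canonwP w : canonw w -> w = address (size w) (pos w).
Proof.
rewrite /canonw /pos; case: ifP => [l _|l /= o].
  by rewrite /address ltnNge leq_addr /= addKn -binE_word.
have e := onehotE o; rewrite /address ifT //.
have h : find id w < size w by rewrite {2}e size_cat /= size_nseq; lia.
case: (ltnP (find id w) (size w).-1) => // ge.
have s0 : size w - (find id w).+1 = 0 by lia.
by move: l; rewrite e s0 last_cat.
Qed.

Lemma canonw_address L v : 1 < L -> canonw (address L v).
Proof.
rewrite /address /canonw => L1; case: ifP => h; last by rewrite last_rcons.
by apply/orP; right; move: (L - v.+1) => r; elim: v {h} => //=; rewrite all_nseq orbT.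
Qed.

Lemma bval_lt w : bval w < 2 ^ (size w).-1.
Proof.
elim: w => //= b [|c w] IH //; move: IH; rewrite [size _]/= [_.+1.-1]/= expnS.
by case: b; lia.
Qed.

Lemma pos_lt w : 1 < size w -> pos w < npos (size w).
Proof.
move=> h; rewrite /pos /npos; case: ifP => _; first by rewrite ltn_add2l bval_lt.
have f1 := find_size id w.
have : 2 ^ 1 <= 2 ^ (size w).-1 by rewrite leq_exp2l //; lia.
by rewrite expn1; lia.
Qed.

(** * Block indices *)

Lemma bin_auxE fuel i : i <= fuel -> bin_aux fuel i = bin i.
Proof.
rewrite /bin; elim: fuel {-2}fuel (leqnn fuel) i => [|m IH] fuel lf i li.
  by move: li lf; case: fuel => //; case: i.
case: fuel lf li => [|fuel] lf li; first by case: i li.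
case: i li => [|i] li //=; congr cons.
by rewrite (IH fuel) ?(IH i) //; lia.
Qed.

Lemma binE i : 0 < i -> bin i = odd i :: bin i./2.
Proof. by case: i => // i _; rewrite {1}/bin /= bin_auxE //; lia. Qed.

Lemma size_bin L i : (size (bin i) <= L) = (i < 2 ^ L).
Proof.
elim: L i => [|L IH] [|i]; rewrite ?expn0 ?expn_gt0 // binE // /= ?ltnS ?IH // expnS; lia.
Qed.

Definition pad L (s : seq bool) := map Some s ++ nseq (L - size s) None.

Lemma size_pad L s : size s <= L -> size (pad L s) = L.
Proof. by move=> h; rewrite size_cat size_map size_nseq subnKC. Qed.

Definition both_none (l : seq (option bool * option bool)) := all (pred1 (None, None)) l.
Fixpoint same_index (l : seq (option bool * option bool)) :=
  if l is a :: l' then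
    (a.1 == a.2) && ((a.1 != None) && same_index l' || (a.1 == Some true) && both_none l')
  else false.
(** Least significant bit first: the cases are 1 against 0, an odd number against its even nonzero
    predecessor, and a borrow. The recursion also forces both tracks to be padded numerals without
    leading zeros. *)
Fixpoint succ_index (l : seq (option bool * option bool)) :=
  if l is a :: l' then
    [|| (a == (Some true, None)) && both_none l', (a == (Some true, Some false)) && same_index l'
      | (a == (Some false, Some true)) && succ_index l']
  else false.

Lemma succ_index_regular : regular succ_index.
Proof.
pose f l := (both_none l, same_index l, succ_index l).
apply: (@regular_fin _ _ _ f (fun a v => let: (n, e, s) := v in
 ((a == (None, None)) && n,
  (a.1 == a.2) && ((a.1 != None) && e || (a.1 == Some true) && n),
  [|| (a == (Some true, None)) && n, (a == (Some true, Some false)) && e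
      | (a == (Some false, Some true)) && s])) snd).
by [].
Qed.

Lemma pad_cons L b s : pad L.+1 (b :: s) = Some b :: pad L s.
Proof. by []. Qed.

Lemma pad0 L : pad L (bin 0) = nseq L None.
Proof. by rewrite /pad /= subn0. Qed.

Lemma both_none_sound l : both_none l -> unzip1 l = pad (size l) (bin 0) /\ unzip2 l = pad (size l) (bin 0).
Proof. by rewrite !pad0; elim: l => //= a l IH /andP [/eqP -> /IH [-> ->]]. Qed.

Lemma bin_bit (b : bool) i : 0 < b + i -> bin (b + i.*2) = b :: bin i.
Proof. by move=> h; rewrite binE ?half_bit_double ?oddD ?odd_double ?oddb ?addbF //; lia. Qed.

Lemma same_index_sound l : same_index l -> exists i, [/\ 0 < i,
  unzip1 l = pad (size l) (bin i) & unzip2 l = pad (size l) (bin i)].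
Proof.
elim: l => //= -[o o'] l IH /= /andP [/eqP <-] /orP [|] /andP [].
  case: o => // b _ /IH [i [i0 -> ->]]; exists (b + i.*2).
  by rewrite bin_bit ?pad_cons; [split=> //; lia|lia].
move=> /eqP -> /both_none_sound [-> ->]; exists 1.
by rewrite -[1]/(true + 0.*2) bin_bit ?pad_cons.
Qed.

Lemma succ_index_sound l : succ_index l -> exists i,
  unzip1 l = pad (size l) (bin i.+1) /\ unzip2 l = pad (size l) (bin i).
Proof.
elim: l => //= a l IH /or3P [] /andP [/eqP ->].
- move=> /both_none_sound [-> ->]; exists 0.
  by rewrite -[1]/(true + 0.*2) bin_bit // !pad_cons !pad0.
- move=> /same_index_sound [i [i0 -> ->]]; exists (false + i.*2).
  have -> : (false + i.*2).+1 = true + i.*2 by [].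
  by rewrite !bin_bit // !pad_cons.
- move=> /IH [i [-> ->]]; exists (true + i.*2).
  have -> : (true + i.*2).+1 = false + i.+1.*2 by lia.
  by rewrite !bin_bit // !pad_cons.
Qed.

Lemma both_none_nseq L : both_none (zip (nseq L None) (nseq L None)).
Proof. by elim: L. Qed.

Lemma same_index_complete L i : 0 < i -> size (bin i) <= L ->
  same_index (zip (pad L (bin i)) (pad L (bin i))).
Proof.
elim: L i => [|L IH] i i0; first by rewrite binE.
rewrite binE // [size _]/= ltnS => h; rewrite !pad_cons /= eqxx /=.
case: (posnP i./2) => [e|p]; last by rewrite IH.
have -> : odd i by have := odd_double_half i; lia.
by rewrite e pad0 both_none_nseq orbT.
Qed.

Lemma succ_index_complete L i : size (bin i.+1) <= L ->
  succ_index (zip (pad L (bin i.+1)) (pad L (bin i))).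
Proof.
elim: L i => [|L IH] i; first by rewrite binE.
rewrite -(odd_double_half i); move: (odd i) (i./2) => [] u.
  have -> : (true + u.*2).+1 = false + u.+1.*2 by lia.
  by rewrite !bin_bit // [size _]/= ltnS !pad_cons => h; rewrite /= IH.
have -> : (false + u.*2).+1 = true + u.*2 by [].
rewrite bin_bit // [size _]/= ltnS => h; rewrite pad_cons.
case: (posnP u) h => [->|u0] h; first by rewrite !pad0 /= both_none_nseq.
by rewrite bin_bit // pad_cons /= same_index_complete.
Qed.

(** The last difference, being the most significant one, decides; padding counts as a zero digit. *)
Fixpoint index_cmp (l : seq (option bool * option bool)) : option bool :=
  if l is a :: l' then
    if index_cmp l' is Some b then Some b
    else if (a.1 == Some true) == (a.2 == Some true) then None else Some (a.2 == Some true)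
  else None.

Lemma index_cmp_regular : regular index_cmp.
Proof. exact: (@regular_fin _ _ _ index_cmp (fun a v => if v is Some b then Some b
    else if (a.1 == Some true) == (a.2 == Some true) then None else Some (a.2 == Some true)) id).
Qed.

Fixpoint oval (l : seq (option bool)) : nat :=
  if l is o :: l' then (o == Some true) + (oval l').*2 else 0.

Lemma oval_pad L i : oval (pad L (bin i)) = i.
Proof.
rewrite /pad; move: (L - _) => k; elim/ltn_ind: i => i IH.
case: (posnP i) => [->|i0]; first by elim: k {IH} => //= k ->.
rewrite binE //= IH; last by lia.
have -> : (Some (odd i) == Some true) = odd i by case: odd.
exact: odd_double_half.
Qed.

Lemma index_cmp_oval a b : size a = size b -> (index_cmp (zip a b) == Some true) = (oval a < oval b).
Proof.
move=> sz.
suff : index_cmp (zip a b) = if oval a == oval b then None else Some (oval a < oval b).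
  by move=> ->; case: ltngtP.
elim: a b sz => [|o a IH] [|o' b] //= [sz]; rewrite IH //.
case: (o == _) (o' == _) => [] []; case: (ltngtP (oval a) (oval b)) => /= h;
  case: ltngtP => /= h2; try by []; lia.
Qed.

Lemma par_pad L i : 0 < i -> (head None (pad L (bin i)) == Some true) = odd i.
Proof. by move=> i0; rewrite /pad binE //=; case: odd. Qed.

Lemma head_regular (Y : Type) (p : Y -> bool) : regular (fun l => if l is a :: _ then p a else false).
Proof. exact: (@regular_fin _ _ _ (fun l : seq Y => if l is a :: _ then p a else false) (fun a _ => p a) id). Qed.

Lemma none_pad L i : size (bin i) <= L -> all (pred1 None) (pad L (bin i)) = (i == 0).
Proof. by case: i => [|i]; [rewrite pad0 all_nseq orbT | rewrite /pad binE]. Qed.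

(** * Oracle words *)

Definition dbl (o : option bool) := if o is Some b then [:: b; b] else [::].

Lemma dbl_pad L s : flatten (map dbl (pad L s)) = flatten (map (fun b => [:: b; b]) s).
Proof.
rewrite /pad map_cat flatten_cat -map_comp /=.
have -> : flatten (map dbl (nseq (L - size s) None)) = [::] by elim: (L - size s).
by rewrite cats0.
Qed.

(** The bits of the index are doubled, so the separator is the first pair of unequal letters; the
    index is recovered from its bits by [oval]. *)
Lemma pair_enc_inj i x j y : pair_enc i x = pair_enc j y -> i = j /\ x = y.
Proof.
suff h s s' : flatten (map (fun b : bool => [:: b; b]) s) ++ [:: false; true] ++ x =
    flatten (map (fun b : bool => [:: b; b]) s') ++ [:: false; true] ++ y -> s = s' /\ x = y.
  by move=> /h [e ->]; split=> //; rewrite -(oval_pad 0 i) e oval_pad.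
elim: s s' => [|b s IH] [|b' s'] /=.
- by case.
- by case=> <-.
- by case=> ->.
- by case=> -> _ /IH [-> ->].
Qed.

Lemma disj_unionE As i u :
  disj_union As (pair_enc i u) <-> 0 < i <= size As /\ nth (fun=> False) As i.-1 u.
Proof.
split=> [[j [v [h [/pair_enc_inj [-> ->] h2]]]]|[h1 h2]] //.
by exists i, u.
Qed.

Section Tail.
Variable D : finType.

Definition dtag (e : D) : seq bool := [seq e == e' | e' <- enum D].

(** Reversed and interleaved, because this is what a leftward sweep over a window emits. *)
Definition tail (t p : seq bool) (e : D) :=
  flatten (map (fun u : bool * bool => [:: u.1; u.2]) (rev (zip t p))) ++ dtag e.

Lemma size_tail t p e : size t = size p -> size (tail t p e) = 2 * size p + #|D|.
Proof.
move=> sz; rewrite size_cat size_map -cardE; congr (_ + _).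
have -> : size p = size (rev (zip t p)) by rewrite size_rev size2_zip ?sz.
by elim: (rev _) => //= u s ->; lia.
Qed.

Lemma dtag_inj : injective dtag.
Proof.
move=> e e' h; have he : e' \in enum D by rewrite mem_enum.
by have := (eq_in_map _ _ _).2 h e' he; rewrite eqxx => /eqP.
Qed.

Lemma tail_inj t p e t' p' e' : size t = size p -> size t' = size p' -> size p = size p' ->
  tail t p e = tail t' p' e' -> [/\ t = t', p = p' & e = e'].
Proof.
move=> s1 s2 s3 h.
have sz : size (rev (zip t p)) = size (rev (zip t' p')) by rewrite !size_rev !size2_zip ?s1 ?s2.
have [hz ->] : rev (zip t p) = rev (zip t' p') /\ e = e'.
  move: h; rewrite /tail; elim: (rev (zip t p)) (rev (zip t' p')) sz => [|[a b] s IH] [|[a' b'] s'] //=.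
    by move=> _ /dtag_inj.
  by move=> [sz] [-> -> /(IH _ sz) [-> ->]].
have := congr1 rev hz; rewrite !revK => {}hz.
have e1 := congr1 unzip1 hz; have e2 := congr1 unzip2 hz.
by rewrite !unzip1_zip ?s1 ?s2 // in e1; rewrite !unzip2_zip ?s1 ?s2 // in e2.
Qed.

End Tail.

(** * Tableaux *)

Lemma In_onth (T : Type) (a : T) s : List.In a s <-> exists k, onth s k = Some a.
Proof.
elim: s => [|b s IH]; first by split=> // -[[]].
split=> [[->|/IH [k h]]|[[|k] h]]; first by exists 0.
- by exists k.+1.
- by left; case: h.
- by right; apply/IH; exists k.
Qed.

Lemma onth_size (T : Type) (a : T) s k : onth s k = Some a -> k < size s.
Proof. by elim: s k => [|b s IH] [|k] //= /IH. Qed.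

Section Tableau.
Variables (M : ATM) (x : seq bool).
Hypothesis hq : qry M = None.
Notation O0 := (fun _ : seq bool => False).

(* Index [None] is the input tape, treated as a tape that is never changed. *)
Notation tix := (option 'I_(ntapes M).+1).
Notation trans := (St M * move * {ffun 'I_(ntapes M).+1 -> Gam M * move})%type.

Definition trs (s : St M) (rd : {ffun tix -> Gam M}) : seq trans :=
  delta s (rd None) [ffun i => rd (Some i)].

Definition dmax := \max_(u : St M * {ffun tix -> Gam M}) size (trs u.1 u.2).

Definition tact (rd : {ffun tix -> Gam M}) (tr : trans) (o : tix) : Gam M * move :=
  if o is Some i then tr.2 i else (rd None, tr.1.2).

Definition klab (s : St M) : option bool :=
  match kind s with KEx => Some true | KUn => Some false | _ => None end.

Definition activ b s rd := (klab s == Some b) && ~~ nilp (trs s rd).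

(** A universal configuration without successors accepts, an existential one rejects; both are
    visible from the state and the symbols read. *)
Definition accst s rd :=
  match kind s with KAcc => true | KUn => nilp (trs s rd) | _ => false end.

Definition cont (c : cfg M) (o : tix) (p : nat) : Gam M :=
  if o is Some i then nth (blank M) (tapes c i).1 p else nth (blank M) (map (sym M) x) p.

Definition hpos (c : cfg M) (o : tix) : nat :=
  if o is Some i then (tapes c i).2 else ihead c.

Definition rdc c : {ffun tix -> Gam M} := [ffun o => cont c o (hpos c o)].

Lemma trs_rdc c : trs (cst c) (rdc c) =
  delta (cst c) (nth (blank M) (map (sym M) x) (ihead c))
        [ffun i => nth (blank M) (tapes c i).1 (tapes c i).2].
Proof. by rewrite /trs ffunE; congr delta; apply/ffunP => i; rewrite !ffunE. Qed.

Lemma succE c c' : succ x O0 c c' <->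
  klab (cst c) <> None /\ exists k tr, onth (trs (cst c) (rdc c)) k = Some tr /\ c' = apply_tr c tr.
Proof.
have -> : (klab (cst c) <> None /\ exists k tr, onth (trs (cst c) (rdc c)) k = Some tr /\ c' = apply_tr c tr)
  <-> (klab (cst c) <> None /\ exists tr, List.In tr (trs (cst c) (rdc c)) /\ c' = apply_tr c tr).
  split=> -[h1]; first by case=> k [tr [h ->]]; split=> //; exists tr; split=> //; apply/In_onth; exists k.
  by case=> tr [/In_onth [k h] ->]; split=> //; exists k, tr.
rewrite /succ hq /klab trs_rdc; case: (kind (cst c)); split=> //; try (by case); by move=> h; split.
Qed.

Lemma cont_apply c tr o p : cont (apply_tr c tr) o p =
  if p == hpos c o then (tact (rdc c) tr o).1 else cont c o p.
Proof.
case: tr => [[s mi] f]; case: o => [i|] /=; last first.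
  by rewrite ffunE /=; case: eqP => [->|].
by rewrite ffunE; case: (tapes c i) => tp q /=; rewrite nth_set_nth.
Qed.

Lemma hpos_apply c tr o : hpos (apply_tr c tr) o = mv (tact (rdc c) tr o).2 (hpos c o).
Proof.
case: tr => [[s mi] f]; case: o => [i|] //=.
by rewrite ffunE; case: (tapes c i).
Qed.

Definition hcell := (Gam M * (bool * bool * bool))%type.
(** State, symbols read and choice are repeated in every cell of a row, and head marks also announce
    heads in the neighbouring cells. This redundancy makes each rule a relation between two cells
    only. *)
Definition cell := (St M * {ffun tix -> Gam M} * 'I_dmax.+1 * {ffun tix -> hcell})%type.

(* [dL], [dC], [dR]: the head of tape [o] is one cell to the left, here, or one *)
(* cell to the right.                                                         *)
Definition dst (e : cell) := e.1.1.1.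
Definition drd (e : cell) := e.1.1.2.
Definition dch (e : cell) := e.1.2.
Definition dsy (e : cell) o := (e.2 o).1.
Definition dL (e : cell) o := (e.2 o).2.1.1.
Definition dC (e : cell) o := (e.2 o).2.1.2.
Definition dR (e : cell) o := (e.2 o).2.2.

Definition hon (c : cfg M) (ch : 'I_dmax.+1) (p : nat) : cell :=
  (cst c, rdc c, ch,
   [ffun o => (cont c o p, ((hpos c o).+1 == p, hpos c o == p, hpos c o == p.+1))]).

Definition urel (first last : bool) (e : cell) :=
  [forall o, [&& dC e o ==> (drd e o == dsy e o), first ==> ~~ dL e o & last ==> ~~ dR e o]].

(** The extra case of [ML] is a head on cell 0, which stays there. *)
Definition moved (m : move) (first l c r : bool) :=
  match m with MR => l | MS => c | ML => r || c && first end.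

(* Within a block owned by [b] the run stutters as soon as [b] is not to move. *)
(* The choice of a step is stored in the row it leads to, so that the first    *)
(* row of a block is chosen by the owner of that block.                        *)
Definition vrel (b first last : bool) (e e' : cell) :=
  urel first last e' &&
  if activ b (dst e) (drd e) then
    if onth (trs (dst e) (drd e)) (dch e') is Some tr then
      (dst e' == tr.1.1) &&
      [forall o, (dsy e' o == if dC e o then (tact (drd e) tr o).1 else dsy e o) &&
         (dC e' o == moved (tact (drd e) tr o).2 first (dL e o) (dC e o) (dR e o))]
    else false
  else (dst e' == dst e) && [forall o, (dsy e' o == dsy e o) && (dC e' o == dC e o)].

Definition hrel (e e' : cell) :=
  [&& dst e == dst e', drd e == drd e', dch e == dch e' &
      [forall o, (dR e o == dC e' o) && (dC e o == dL e' o)]].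

Definition isym (z : option bool) := if z is Some b then sym M b else blank M.

Definition irel (z : option bool) (first last : bool) (e : cell) :=
  [&& urel first last e, dst e == start M &
      [forall o : tix, (dsy e o == if o is None then isym z else blank M) && (dC e o == first)]].

Definition bstep b c c' :=
  if activ b (cst c) (rdc c) then succ x O0 c c' else c' = c.

Lemma dsy_hon c ch p o : dsy (hon c ch p) o = cont c o p.
Proof. by rewrite /dsy ffunE. Qed.
Lemma dL_hon c ch p o : dL (hon c ch p) o = ((hpos c o).+1 == p).
Proof. by rewrite /dL ffunE. Qed.
Lemma dC_hon c ch p o : dC (hon c ch p) o = (hpos c o == p).
Proof. by rewrite /dC ffunE. Qed.
Lemma dR_hon c ch p o : dR (hon c ch p) o = (hpos c o == p.+1).
Proof. by rewrite /dR ffunE. Qed.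
Definition honE := (dsy_hon, dL_hon, dC_hon, dR_hon).

Lemma hrel_hon c ch p : hrel (hon c ch p) (hon c ch p.+1).
Proof. by apply/and4P; split=> //; apply/forallP => o; rewrite !honE eqSS !eqxx. Qed.

Lemma urel_hon c ch p (last : bool) : (last -> forall o, hpos c o != p.+1) ->
  urel (p == 0) last (hon c ch p).
Proof.
move=> h; apply/forallP => o; rewrite !honE; apply/and3P; split; apply/implyP.
- by move/eqP => <-; rewrite /drd ffunE.
- by move/eqP->.
- by move/h.
Qed.

Lemma moved_hpos m h p :
  (mv m h == p) = moved m (p == 0) (h.+1 == p) (h == p) (h == p.+1).
Proof. by case: m => //=; case: h => [|h] //=; case: p => [|p] //=; lia. Qed.

Lemma vrel_hon b c c' : bstep b c c' -> exists ch', forall ch p (last : bool),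
  (last -> forall o, hpos c' o != p.+1) ->
  vrel b (p == 0) last (hon c ch p) (hon c' ch' p).
Proof.
rewrite /bstep; case: ifP => [a /succE [_ [k [tr [hk ->]]]]|a ->]; last first.
  exists ord0 => ch p last h; rewrite /vrel urel_hon // a eqxx.
  by apply/forallP => o; rewrite !honE !eqxx.
have lk : k < dmax.+1.
  rewrite ltnS (leq_trans (ltnW (onth_size hk))) //.
  exact: (leq_bigmax (cst c, rdc c)).
exists (Ordinal lk) => ch p last h; rewrite /vrel urel_hon // a /= hk.
have -> : dst (hon (apply_tr c tr) (Ordinal lk) p) = tr.1.1 by case: tr {hk h} => -[].
rewrite eqxx; apply/forallP => o; rewrite !honE cont_apply hpos_apply moved_hpos.
by rewrite [p == _]eq_sym !eqxx.
Qed.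

Lemma irel_hon ch z p (last : bool) :
  isym z = nth (blank M) (map (sym M) x) p ->
  irel z (p == 0) last (hon (init_cfg M) ch p).
Proof.
move=> hz.
have h0 o : hpos (init_cfg M) o = 0 by case: o => //= i; rewrite ffunE.
apply/and3P; split=> //; first by apply: urel_hon => _ o; rewrite h0.
apply/forallP => o; rewrite !honE h0 [0 == p]eq_sym eqxx andbT.
by case: o => [i|] /=; rewrite ?ffunE ?hz ?nth_nil eqxx.
Qed.

Section Rows.
Variable N : nat.

Definition row_ok (R : nat -> cell) :=
  (forall p, p.+1 < N -> hrel (R p) (R p.+1)) /\
  (forall p, p < N -> urel (p == 0) (p.+1 == N) (R p)).

(** The redundant components are forced. The symbols read agree along the row and are checked where
    the heads are, which needs the heads to lie within the row; the side marks come from the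
    neighbours or from the borders. *)
Lemma row_hon R c : row_ok R -> (forall o, hpos c o < N) ->
  (forall p, p < N -> [/\ dst (R p) = cst c, forall o, dsy (R p) o = cont c o p
                        & forall o, dC (R p) o = (hpos c o == p)]) ->
  forall p, p < N -> R p = hon c (dch (R 0)) p.
Proof.
move=> [hH hU] hN h.
have hc p : p < N -> drd (R p) = drd (R 0) /\ dch (R p) = dch (R 0).
  elim: p => // p IH lp; have [<- <-] := IH (ltnW lp).
  by have /and4P [_ /eqP -> /eqP ->] := hH p lp.
have hr p : p < N -> drd (R p) = rdc c.
  move=> lp; apply/ffunP => o; rewrite (hc p lp).1 -(hc _ (hN o)).1 ffunE.
  have [_ h1 h2] := h _ (hN o).
  have /forallP /(_ o) /and3P [/implyP] := hU _ (hN o).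
  by rewrite h1 h2 eqxx => /(_ isT) /eqP.
move=> p lp; have [h1 h2 h3] := h p lp.
have hL o : dL (R p) o = ((hpos c o).+1 == p).
  case: p lp h1 h2 h3 => [|p] lp h1 h2 h3.
    by have /forallP /(_ o) /and3P [_ /implyP /(_ isT) /negbTE] := hU _ lp.
  have /and4P [_ _ _ /forallP /(_ o) /andP [_ /eqP <-]] := hH p lp.
  by have [_ _ ->] := h p (ltnW lp); rewrite eqSS.
have hR o : dR (R p) o = (hpos c o == p.+1).
  have [lp1|ge] := ltnP p.+1 N.
    have /and4P [_ _ _ /forallP /(_ o) /andP [/eqP -> _]] := hH p lp1.
    by have [_ _ ->] := h _ lp1.
  have eN : p.+1 = N by apply/eqP; rewrite eqn_leq lp ge.
  have /forallP /(_ o) /and3P [_ _] := hU _ lp; rewrite eN eqxx /= => /negbTE ->.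
  by rewrite ltn_eqF.
have e2 : (R p).2 = (hon c (dch (R 0)) p).2.
  apply/ffunP => o; rewrite ffunE -h2 -h3 -hL -hR /dsy /dL /dC /dR.
  by case: ((R p).2 o) => ? [[]].
rewrite -(hc p lp).2; move: h1 (hr p lp) e2; rewrite /dst /drd /dch /hon.
by case: (R p) => [[[s r] k] f] /= -> -> ->.
Qed.

Lemma row_init R z : row_ok R -> 0 < N ->
  (forall p, p < N -> isym (z p) = nth (blank M) (map (sym M) x) p) ->
  (forall p, p < N -> irel (z p) (p == 0) (p.+1 == N) (R p)) ->
  forall p, p < N -> R p = hon (init_cfg M) (dch (R 0)) p.
Proof.
move=> hR N0 hz hI.
have h0 o : hpos (init_cfg M) o = 0 by case: o => //= i; rewrite ffunE.
apply: row_hon hR _ _ => [o|p lp]; first by rewrite h0.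
have /and3P [_ /eqP h1 /forallP h2] := hI p lp; split=> // o.
  have /andP [/eqP -> _] := h2 o; case: o => [i|] /=; last exact: hz.
  by rewrite ffunE nth_nil.
by have /andP [_ /eqP ->] := h2 o; rewrite h0 eq_sym.
Qed.

(** The choice is constant along the new row, so all its cells follow one and the same
    transition. *)
Lemma row_step b R R' c ch : row_ok R' -> 0 < N ->
  (forall c', bstep b c c' -> forall o, hpos c' o < N) ->
  (forall p, p < N -> R p = hon c ch p) ->
  (forall p, p < N -> vrel b (p == 0) (p.+1 == N) (R p) (R' p)) ->
  exists c', bstep b c c' /\ forall p, p < N -> R' p = hon c' (dch (R' 0)) p.
Proof.
move=> hR' N0 hN hR hV.
have hc p : p < N -> dch (R' p) = dch (R' 0).
  elim: p => // p IH lp; rewrite -(IH (ltnW lp)).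
  by have /and4P [_ _ /eqP ->] := hR'.1 p lp.
case: (boolP (activ b (cst c) (rdc c))) => a; last first.
  have hb : bstep b c c by rewrite /bstep (negbTE a).
  exists c; split=> //; apply: row_hon hR' (hN _ hb) _ => p lp.
  have /andP [_] := hV p lp; rewrite hR // [activ _ _ _](negbTE a).
  move=> /andP [/eqP h1 /forallP h2]; split=> // o.
    by have /andP [/eqP -> _] := h2 o; rewrite !honE.
  by have /andP [_ /eqP ->] := h2 o; rewrite !honE.
have /andP [_] := hV 0 N0; rewrite hR // [activ _ _ _]a -/(dst _).
case E : (onth _ _) => [tr|//] _.
have hb : bstep b c (apply_tr c tr).
  rewrite /bstep a; apply/succE; split; last by exists (dch (R' 0)), tr.
  by move: a; rewrite /activ => /andP [/eqP ->].
exists (apply_tr c tr); split=> //; apply: row_hon hR' (hN _ hb) _ => p lp.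
have /andP [_] := hV p lp; rewrite hR // [activ _ _ _]a hc //.
rewrite -[dst (hon c ch p)]/(dst (hon c ch 0)) -[drd (hon c ch p)]/(drd (hon c ch 0)) E.
move=> /andP [/eqP h1 /forallP h2]; split=> [|o|o].
- by rewrite h1; case: (tr) => -[].
- by have /andP [/eqP -> _] := h2 o; rewrite !honE cont_apply eq_sym.
- by have /andP [_ /eqP ->] := h2 o; rewrite !honE hpos_apply moved_hpos.
Qed.

End Rows.
End Tableau.

(** * Blocks of a run *)

Section Blocks.
Variables (M : ATM) (x : seq bool).
Hypothesis hq : qry M = None.
Notation O0 := (fun _ : seq bool => False).
Notation acc := (accepts x O0).
Notation init := (init_cfg M).
Implicit Type c : cfg M.

Definition actc b (c : cfg M) := activ b (cst c) (rdc x c).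
Definition accc (c : cfg M) := accst (cst c) (rdc x c).

Lemma no_query (s : St M) : is_query_state s = false.
Proof. by rewrite /is_query_state hq. Qed.

Lemma nilp_succ c c' : nilp (trs (cst c) (rdc x c)) -> ~ succ x O0 c c'.
Proof. by move=> /nilP e /succE [//|_ [k [tr []]]]; rewrite e; case: k. Qed.

Lemma acc_bstep_ex c : acc c <-> exists c', bstep x true c c' /\ acc c'.
Proof.
rewrite /bstep -/(actc _ _); case: (boolP (actc _ _)) => a; last first.
  by split=> [h|[c' [->]]] //; exists c.
rewrite accepts_exE ?no_query //.
by move: a => /andP [/eqP + _]; rewrite /klab; case: kind.
Qed.

Lemma acc_bstep_un c : acc c <-> forall c', bstep x false c c' -> acc c'.
Proof.
rewrite /bstep -/(actc _ _); case: (boolP (actc _ _)) => a; last first.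
  by split=> [h c' -> //|h]; exact: h.
rewrite accepts_unE ?no_query //.
by move: a => /andP [/eqP + _]; rewrite /klab; case: kind.
Qed.

Lemma acc_halted c : (forall b, ~~ actc b c) -> acc c <-> accc c.
Proof.
move=> h; have := h true; have := h false.
rewrite /actc /activ /accc /accst /klab; case E : (kind (cst c)) => /= h1 h2.
- split=> //; rewrite accepts_exE ?no_query // => -[c' [s _]].
  by exfalso; apply: nilp_succ s; rewrite negbK in h2.
- rewrite negbK in h1; rewrite h1; split=> // _; rewrite accepts_unE ?no_query // => c' s.
  by exfalso; exact: nilp_succ s.
- by split=> // _; apply: acc_acc; rewrite ?no_query.
- by split=> // /accepts_rejE; rewrite no_query; case.
Qed.

Lemma accc_halted c b : accc c -> ~~ actc b c.
Proof. by rewrite /accc /actc /activ /accst /klab; case: kind => //= ->; rewrite andbF. Qed.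

Fixpoint bsteps b n (c c' : cfg M) : Prop :=
  if n is m.+1 then exists c1, bstep x b c c1 /\ bsteps b m c1 c' else c' = c.

Lemma acc_bsteps_ex n c : acc c <-> exists c', bsteps true n c c' /\ acc c'.
Proof.
elim: n c => [|n IH] c /=; first by split=> [h|[c' [->]]] //; exists c.
rewrite acc_bstep_ex; split=> [[c1 [h1 /IH [c' [h2 h3]]]]|[c' [[c1 [h1 h2]] h3]]].
  by exists c'; split=> //; exists c1.
by exists c1; split=> //; apply/IH; exists c'.
Qed.

Lemma acc_bsteps_un n c : acc c <-> forall c', bsteps false n c c' -> acc c'.
Proof.
elim: n c => [|n IH] c /=; first by split=> [h c' -> //|h]; exact: h.
rewrite acc_bstep_un; split=> [h c' [c1 [h1 h2]]|h c1 h1].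
  exact: (IH c1).1 (h _ h1) _ h2.
by apply/IH => c' h2; apply: h; exists c1.
Qed.

Lemma bsteps_inactive b n c c' : ~~ actc b c -> bsteps b n c c' -> c' = c.
Proof.
move=> a; elim: n => //= n IH [c1 []].
by rewrite /bstep [activ _ _ _](negbTE a) => ->.
Qed.

Definition sw_incr (c c' : cfg M) : nat :=
  (klab (cst c') != None) && (klab (cst c) != klab (cst c')).

(** The numbers are the steps made and the alternations counted so far; halting states without a
    label open no new block. *)
Inductive reach : cfg M -> nat -> nat -> Prop :=
| reach0 : reach init 0 1
| reachS c k nb c' : reach c k nb -> succ x O0 c c' -> reach c' k.+1 (nb + sw_incr c c').

Lemma reach_hpos c k nb o : reach c k nb -> hpos c o <= k.
Proof.
elim=> [|{}c {}k {}nb c' _ IH /succE [//|_ [j [tr [_ ->]]]]].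
  by case: o => //= i; rewrite ffunE.
rewrite (hpos_apply x); case: (tact _ _ _) => g m /=; case: m => /=; lia.
Qed.

Lemma reach_le c k nb : reach c k nb -> nb <= k.+1.
Proof. by elim=> // {}c {}k {}nb c' _ IH _; rewrite /sw_incr; lia. Qed.

Lemma is_path_rcons c cs c' : is_path x O0 c (rcons cs c') <->
  is_path x O0 c cs /\ succ x O0 (last c cs) c'.
Proof.
elim: cs c => [|c1 cs IH] c /=; first by split; case.
by rewrite IH; tauto.
Qed.

Lemma switches_rcons b s b0 b1 :
  switches b (rcons (rcons s b0) b1) = switches b (rcons s b0) + (b0 != b1).
Proof. by elim: s b => [|b2 s IH] b /=; rewrite ?addn0 // IH addnA. Qed.

Lemma nblocks_rcons s b0 b1 :
  nblocks (rcons (rcons s b0) b1) = nblocks (rcons s b0) + (b0 != b1).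
Proof. by case: s => [|b2 s] /=; rewrite ?addn0 ?switches_rcons. Qed.

Lemma label_klab (c : cfg M) : label c = klab (cst c).
Proof. by rewrite /label no_query. Qed.

Lemma reach_path c k nb : klab (start M) != None -> reach c k nb ->
  exists cs, [/\ is_path x O0 init cs, last init cs = c, size cs = k
               & nblocks (pmap (@label M) (init :: cs)) = nb].
Proof.
move=> hk; elim=> [|{}c {}k {}nb c' _ [cs [h1 h2 h3 h4]] s].
  exists [::]; split=> //; rewrite /= label_klab /=.
  by case: klab hk.
exists (rcons cs c'); split.
- by apply/is_path_rcons; rewrite h2.
- by rewrite last_rcons.
- by rewrite size_rcons h3.
have [hc _] := (succE x hq c c').1 s.
move: h4; rewrite -rcons_cons pmap_rcons (lastI init cs) h2 pmap_rcons.
rewrite !label_klab /sw_incr => h4.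
case: (klab (cst c)) hc h4 => // b0 _; rewrite cats1 /=.
case: (klab (cst c')) => [b1|] /=; last by rewrite cats0 addn0.
by rewrite cats1 nblocks_rcons (inj_eq Some_inj) => ->.
Qed.

(** A run on which [b] is still active at the end never stuttered, so it made [n] real steps, which
    the time bound excludes for large [n]. If the move has passed from [b] to the opponent, some
    step on the way counted an alternation. *)
Lemma bsteps_reach b n c c' k nb : bsteps b n c c' -> reach c k nb ->
  exists k' nb', [/\ reach c' k' nb', nb <= nb',
    klab (cst c) = Some b -> klab (cst c') = Some (~~ b) -> nb < nb'
    & actc b c' -> k' = k + n].
Proof.
elim: n c k nb => [|n IH] c k nb /=.
  move=> -> r; exists k, nb; split=> // [->|]; first by case; case: (b).
  by rewrite addn0.
case=> c1 [h1 h2] r; case: (boolP (actc b c)) => a; last first.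
  move: h1; rewrite /bstep [activ _ _ _](negbTE a) => ec; rewrite ec in h2.
  have ec' := bsteps_inactive a h2; rewrite ec'; exists k, nb; split=> //.
    by move=> -> []; case: (b).
  by rewrite (negbTE a).
move: h1; rewrite /bstep [activ _ _ _]a => s.
have r1 := reachS r s; have [k' [nb' [q1 q2 q3 q4]]] := IH _ _ _ h2 r1.
exists k', nb'; split=> //.
- by apply: leq_trans q2; exact: leq_addr.
- move=> l l'; case E : (klab (cst c1)) => [b1|].
    case: (b1 =P b) => [eb|nb1].
      by apply: leq_ltn_trans (q3 _ l'); rewrite ?leq_addr // E eb.
    apply: leq_trans q2; rewrite /sw_incr E l /= (inj_eq Some_inj).
    by case: (b) nb1; case: (b1) => //= _; rewrite addn1.
  have na : ~~ actc b c1 by rewrite /actc /activ E.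
  by move: l'; rewrite (bsteps_inactive na h2) E.
- by move=> /q4 ->; rewrite addSnnS.
Qed.

Lemma bsteps_fun b n c c' : bsteps b n c c' ->
  exists C : nat -> cfg M, [/\ C 0 = c, C n = c' & forall k, k < n -> bstep x b (C k) (C k.+1)].
Proof.
elim: n c => [|n IH] c /=; first by move=> ->; exists (fun=> c).
case=> c1 [h1 /IH [C [h2 h3 h4]]].
exists (fun k => if k is j.+1 then C j else c); split=> // -[|k] lk; first by rewrite h2.
exact: h4.
Qed.

Lemma bsteps_rcons b n c c1 c' : bsteps b n c c1 -> bstep x b c1 c' -> bsteps b n.+1 c c'.
Proof.
elim: n c => [|n IH] c /= h1 h2; first by exists c'; rewrite -h1.
by case: h1 => c2 [h3 h4]; exists c2; split=> //; exact: IH.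
Qed.

End Blocks.

(** * Windows *)

Section RegularApp.
Variable Y : Type.

Lemma regular_cst T (a : T) : regular (fun _ : seq Y => a).
Proof. by exists unit, tt, (fun _ _ => tt), (fun=> a). Qed.

Lemma regular_app A B (g : seq Y -> A -> B) (f : seq Y -> A) :
  regular g -> regular f -> regular (fun s => g s (f s)).
Proof. exact: (regular_pair (fun g a => g a)). Qed.

End RegularApp.

Record flags := Flags {
  f_ok : bool; f_one : bool; f_odd : bool;
  f_eqt : bool; f_adjt : bool; f_lastt : bool; f_firstt : bool;
  f_eqp : bool; f_adjp : bool; f_firstp : bool; f_lastp : bool;
  f_inp : option bool }.

(* A letter of a window holds one letter of each of its tracks: the padded   *)
(* block number [i], the padded [i.-1], and two pairs (time, cell).           *)
Notation letter := ((option bool * option bool) * ((bool * bool) * (bool * bool)))%type.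
Definition xi (a : letter) := a.1.1.
Definition xj (a : letter) := a.1.2.
Definition xt1 (a : letter) := a.2.1.1.
Definition xp1 (a : letter) := a.2.1.2.
Definition xt2 (a : letter) := a.2.2.1.
Definition xp2 (a : letter) := a.2.2.2.

Definition wflags (l : seq (letter * option bool)) : flags :=
  Flags
    (succ_index (map (fun a => (xi a.1, xj a.1)) l))
    (all (pred1 None) (map (fun a => xj a.1) l))
    (if l is a :: _ then xi a.1 == Some true else false)
    (all (fun a => xt1 a.1 == xt2 a.1) l)
    (adj (map (fun a => (xt1 a.1, xt2 a.1)) l))
    (all (fun a => xt1 a.1) l)
    (firstw (map (fun a => xt2 a.1) l))
    (all (fun a => xp1 a.1 == xp2 a.1) l && canonw (map (fun a => xp1 a.1) l))
    (adj (map (fun a => (xp1 a.1, xp2 a.1)) l))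
    (firstw (map (fun a => xp2 a.1) l))
    (all (fun a => xp2 a.1) l)
    (inpw (map (fun a => (xp2 a.1, a.2)) l)).

Lemma wflags_regular : regular wflags.
Proof.
pose W := (letter * option bool)%type.
have r := regular_app (regular_cst W Flags) (regular_map (fun a : W => (xi a.1, xj a.1)) succ_index_regular).
have {}r := regular_app r (regular_map (fun a : W => xj a.1) (all_regular (pred1 None))).
have {}r := regular_app r (head_regular (fun a : W => xi a.1 == Some true)).
have {}r := regular_app r (all_regular (fun a : W => xt1 a.1 == xt2 a.1)).
have {}r := regular_app r (regular_map (fun a : W => (xt1 a.1, xt2 a.1)) adj_regular).
have {}r := regular_app r (all_regular (fun a : W => xt1 a.1)).
have {}r := regular_app r (regular_map (fun a : W => xt2 a.1) firstw_regular).
have {}r := regular_app r (regular_pair andb (all_regular (fun a : W => xp1 a.1 == xp2 a.1))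
                             (regular_map (fun a : W => xp1 a.1) canonw_regular)).
have {}r := regular_app r (regular_map (fun a : W => (xp1 a.1, xp2 a.1)) adj_regular).
have {}r := regular_app r (regular_map (fun a : W => xp2 a.1) firstw_regular).
have {}r := regular_app r (all_regular (fun a : W => xp2 a.1)).
exact: (regular_app r (regular_map (fun a : W => (xp2 a.1, a.2)) inpw_regular)).
Qed.

(** The value of [wflags] on a well-formed window, in terms of the objects its tracks encode. *)
Definition sflags (i : nat) (t1 p1 t2 p2 : seq bool) (z : seq (option bool)) :=
  Flags true (i == 1) (odd i) (t1 == t2) (adj (zip t1 t2)) (all id t1) (firstw t2)
    ((p1 == p2) && canonw p1) (adj (zip p1 p2)) (firstw p2) (all id p2) (inpw (zip p2 z)).

Lemma map_zip1 (S T U : Type) (g : S -> U) (s : seq S) (t : seq T) :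
  size s = size t -> map (fun a => g a.1) (zip s t) = map g s.
Proof. by elim: s t => [|a s IH] [|b t] //= [/IH ->]. Qed.

Lemma zip_map2 (S T U : Type) (f : S -> T) (g : S -> U) s :
  zip (map f s) (map g s) = map (fun a => (f a, g a)) s.
Proof. by elim: s => //= a s ->. Qed.

Lemma all_zip1 (S T : Type) (g : S -> bool) (s : seq S) (t : seq T) :
  size s = size t -> all (fun a => g a.1) (zip s t) = all g s.
Proof. by elim: s t => [|a s IH] [|b t] //= [/IH ->]. Qed.

Lemma all_eq_map (S : Type) (T : eqType) (f g : S -> T) s :
  all (fun a => f a == g a) s = (map f s == map g s).
Proof. by elim: s => //= a s ->; rewrite eqseq_cons. Qed.

Lemma wflagsE w z i : size w = size z -> 0 < i -> size (bin i) <= size w ->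
  map xi w = pad (size w) (bin i) -> map xj w = pad (size w) (bin i.-1) ->
  wflags (zip w z) =
  sflags i (map xt1 w) (map xp1 w) (map xt2 w) (map xp2 w) z.
Proof.
move=> sz i0 si hi hj; rewrite /wflags /sflags.
rewrite (map_zip1 (fun a => (xi a, xj a))) // -zip_map2 hi hj.
have -> : succ_index (zip (pad (size w) (bin i)) (pad (size w) (bin i.-1))).
  by case: i i0 si {hi hj} => // i _; exact: succ_index_complete.
rewrite (map_zip1 xj) // hj none_pad; last first.
  by move: si; rewrite !size_bin; lia.
have -> : (i.-1 == 0) = (i == 1) by lia.
have -> : (if zip w z is a :: _ then xi a.1 == Some true else false) = odd i.
  rewrite -(par_pad (size w) i0) -hi.
  by case: w z sz {si hi hj} => [|a w] [|b z].
rewrite (all_zip1 (fun a => xt1 a == xt2 a)) // all_eq_map.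
rewrite (map_zip1 (fun a => (xt1 a, xt2 a))) // -zip_map2.
rewrite (all_zip1 xt1) // -(all_map xt1 id) (map_zip1 xt2) //.
rewrite (all_zip1 (fun a => xp1 a == xp2 a)) // all_eq_map.
rewrite (map_zip1 xp1) // (map_zip1 (fun a => (xp1 a, xp2 a))) // -zip_map2.
rewrite (map_zip1 xp2) // (all_zip1 xp2) // -(all_map xp2 id).
congr (Flags _ _ _ _ _ _ _ _ _ _ _ (inpw _)).
by elim: w z sz {si hi hj} => [|a w IH] [|b z] //= [/IH ->].
Qed.

Lemma wflags_ok w z : size w = size z -> f_ok (wflags (zip w z)) ->
  exists i, [/\ 0 < i, size (bin i) <= size w, map xi w = pad (size w) (bin i)
              & map xj w = pad (size w) (bin i.-1)].
Proof.
move=> sz /=; rewrite (map_zip1 (fun a => (xi a, xj a))) // => /succ_index_sound [i [h1 h2]].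
have e1 : map xi w = pad (size w) (bin i.+1).
  by rewrite size_map in h1; rewrite -h1 /unzip1 -map_comp.
have e2 : map xj w = pad (size w) (bin i).
  by rewrite size_map in h2; rewrite -h2 /unzip2 -map_comp.
exists i.+1; split=> //.
have := congr1 size e1; rewrite size_map /pad size_cat size_map size_nseq; lia.
Qed.

(** * The referee and its machine *)

Section Windows.
Variables (D : finType) (hr : rel D) (vr : bool -> bool -> bool -> rel D).
Variables (ir : option bool -> bool -> bool -> pred D).
Variables (dact : bool -> pred D) (dacc : pred D).
Variables (Qsig : bool) (d : nat).
Notation bits := {ffun D -> bool}.

Definition owner i := if odd i then Qsig else ~~ Qsig.

(** The choice made by [pick] gives every oracle content a meaning, so no rule has to forbid several
    cell values at one address. *)
Definition decB (b : bits) : option D := [pick e | b e].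

Definition bitsA As i t p : bits :=
  [ffun e => `[< disj_union As (pair_enc i (tail t p e)) >]].
Definition cellA As i t p := decB (bitsA As i t p).

Definition orel (r : rel D) (o o' : option D) :=
  if o is Some e then if o' is Some e' then r e e' else false else false.

(* Rule 0 compares neighbouring cells of a row, rule 1 consecutive rows of a   *)
(* block, rule 2 the last row of block [i.-1] with the first row of block [i], *)
(* rule 3 the first row of block 1 with the initial configuration; rule 4 is   *)
(* never violated and marks a claim of acceptance.                             *)
Definition viol (own : bool) (fl : flags) (r : nat) (c1 c2 : option D) : bool :=
  match r with
  | 0 => [&& f_eqt fl, f_adjp fl & ~~ orel hr c1 c2]
  | 1 => [&& f_adjt fl, f_eqp fl & ~~ orel (vr own (f_firstp fl) (f_lastp fl)) c1 c2]
  | 2 => [&& ~~ f_one fl, f_lastt fl, f_firstt fl, f_eqp fl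
           & ~~ orel (vr own (f_firstp fl) (f_lastp fl)) c1 c2]
  | 3 => [&& f_one fl, f_firstt fl
           & ~~ (if c2 is Some e then ir (f_inp fl) (f_firstp fl) (f_lastp fl) e else false)]
  | _ => false
  end.

Definition evact b (o : option D) := if o is Some e then dact b e else false.
Definition evacc (o : option D) := if o is Some e then dacc e else false.

Definition block1 (r i : nat) := if r == 2 then i.-1 else i.

Section Input.
Variable x : seq bool.
Let L := glen d x.
Let z := padded d x.

Definition violS As i r t1 p1 t2 p2 :=
  viol (owner i) (sflags i t1 p1 t2 p2 z) r (cellA As (block1 r i) t1 p1) (cellA As i t2 p2).

Definition valid As i := forall r t1 p1 t2 p2, r < 5 -> size t1 = L -> size p1 = L ->
  size t2 = L -> size p2 = L -> violS As i r t1 p1 t2 p2 = false.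

Definition ev As i := cellA As i (nseq L true) (nseq L true).

(* The existential player wins by exhibiting the first fault of the opponent   *)
(* or an accepting end of block [i.-1]. For [i > 1] a fault only counts if the *)
(* run is still active: block [i] may not exist, and then reads as empty.      *)
Definition referee As := exists i, [/\ 0 < i, size (bin i) <= L,
  [/\ owner i = false, ~ valid As i & i = 1 \/ evact false (ev As i.-1)] \/
  1 < i /\ evacc (ev As i.-1)
  & forall j, 0 < j < i -> owner j = true -> valid As j].

End Input.

(** A claim gives a rule and the alleged bits at the two cells of the window and at the last cell of
    the preceding block. A test in [K] selects one bit: the window, whether block [i.-1] is meant,
    the address pair, and the cell value. *)
Notation F := ('I_5 * bits * bits * bits)%type.
Notation K := (bool * (bool * bool) * D)%type.
Notation Y := (letter * option bool * letter)%type.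

Definition kletter (k : K) (y : Y) : letter := if k.1.1 then y.2 else y.1.1.
Definition wem1 (k : K) (y : Y) := let a := kletter k y in
  dbl (if k.1.2.1 then xj a else xi a).
Definition wem2 (k : K) (y : Y) := let a := kletter k y in
  if k.1.2.2 then if k.1.2.1 then [:: true; true] else [:: xt2 a; xp2 a]
  else [:: xt1 a; xp1 a].
Definition wtag (k : K) := dtag k.2.

Definition info (y : seq Y) :=
  (wflags (map fst y), wflags (map (fun a => (a.2, a.1.2)) y),
   index_cmp (map (fun a => (xi a.2, xi a.1.1)) y)).

Lemma info_regular : regular info.
Proof.
apply: (regular_pair pair); last exact: regular_map index_cmp_regular.
by apply: (regular_pair pair); exact: regular_map wflags_regular.
Qed.

Definition ftests (s : bool) (f : F) : seq (K * bool) :=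
  let: (r, b1, b2, b3) := f in
  [seq ((s, (val r == 2, false), e), b1 e) | e <- enum D] ++
  [seq ((s, (false, true), e), b2 e) | e <- enum D] ++
  [seq ((s, (true, true), e), b3 e) | e <- enum D].

Definition own (fl : flags) := if f_odd fl then Qsig else ~~ Qsig.

Definition good (f : F) (fl : flags) :=
  let: (r, b1, b2, b3) := f in
  f_ok fl &&
  ([&& own fl == false, viol (own fl) fl r (decB b1) (decB b2)
     & f_one fl || evact false (decB b3)] ||
   [&& val r == 4, ~~ f_one fl & evacc (decB b3)]).

Definition bad (f : F) (fl : flags) (lt : option bool) :=
  let: (r, b1, b2, b3) := f in
  [&& f_ok fl, own fl == true, viol (own fl) fl r (decB b1) (decB b2) & lt == Some true].

Definition wut (f f' : F) (v : flags * flags * option bool) :=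
  if good f v.1.1 then ftests false f else [::].
(** [Some [::]] is an empty disjunction and makes a claim that is not [good] fail; [None] dismisses
    an allegation that is not [bad]. A proper allegation is refuted by one of its tests with the
    expected answer negated. *)
Definition wet (f f' : F) (v : flags * flags * option bool) :=
  if good f v.1.1 then
    if bad f' v.1.2 v.2 then Some [seq (kb.1, ~~ kb.2) | kb <- ftests true f'] else None
  else Some [::].

Lemma ansE (O : seq bool -> Prop) w b : ans O w b <-> b = `[< O w >].
Proof. by rewrite /ans; case: b; case: asboolP. Qed.

Lemma word_tail s prev sel e w w' (z : seq (option bool)) i :
  size w = size z -> size w' = size z -> let ws := if s then w' else w in
  map xi ws = pad (size ws) (bin i) -> map xj ws = pad (size ws) (bin i.-1) ->
  oword wem1 wem2 wtag (s, (prev, sel), e) (zip (zip w z) w') =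
  pair_enc (if prev then i.-1 else i)
    (tail (if sel then if prev then nseq (size ws) true else map xt2 ws else map xt1 ws)
          (if sel then if prev then nseq (size ws) true else map xp2 ws else map xp1 ws) e).
Proof.
move=> s1 s2 ws hi hj; pose k := (s, (prev, sel), e).
have hm U (g : letter -> U) : map (fun y => g (kletter k y)) (zip (zip w z) w') = map g ws.
  rewrite /ws /kletter /=; case: (s).
    by rewrite (map_comp g snd) -/(unzip2 _) unzip2_zip // s2 size2_zip ?s1.
  rewrite (map_zip1 (fun y => g y.1)) ?size2_zip ?s1 ?s2 //.
  exact: map_zip1.
rewrite /oword /pair_enc /tail; congr (_ ++ _ ++ _ ++ _).
  rewrite (hm _ (fun a => dbl (if prev then xj a else xi a))).
  rewrite (map_comp dbl (fun a => if prev then xj a else xi a)).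
  by case: (prev); rewrite ?hi ?hj dbl_pad.
rewrite map_rev [in RHS]map_rev; congr (flatten (rev _)).
rewrite (hm _ (fun a => if sel then if prev then [:: true; true] else [:: xt2 a; xp2 a]
  else [:: xt1 a; xp1 a])).
case: (sel); last by rewrite zip_map2 -map_comp.
case: (prev); last by rewrite zip_map2 -map_comp.
by elim: (ws) => //= a l ->.
Qed.

Lemma ftests_match As s (r : 'I_5) b1 b2 b3 w w' (z : seq (option bool)) i :
  size w = size z -> size w' = size z -> let ws := if s then w' else w in
  map xi ws = pad (size ws) (bin i) -> map xj ws = pad (size ws) (bin i.-1) ->
  (forall kb, List.In kb (ftests s (r, b1, b2, b3)) ->
     ans (disj_union As) (oword wem1 wem2 wtag kb.1 (zip (zip w z) w')) kb.2) <->
  [/\ b1 = bitsA As (block1 r i) (map xt1 ws) (map xp1 ws),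
      b2 = bitsA As i (map xt2 ws) (map xp2 ws)
    & b3 = bitsA As i.-1 (nseq (size ws) true) (nseq (size ws) true)].
Proof.
move=> s1 s2 ws hi hj.
have hen (e : D) : List.In e (enum D) by apply/In_mem; rewrite mem_enum.
have hw prev sel e := @word_tail s prev sel e w w' z i s1 s2 hi hj.
split=> [h|[-> -> ->] kb].
  split; apply/ffunP => e; rewrite ffunE.
  - have := h ((s, (val r == 2, false), e), b1 e); rewrite hw /= ansE /block1; apply.
    by apply/In_cat; left; apply/In_map; exists e.
  - have := h ((s, (false, true), e), b2 e); rewrite hw /= ansE; apply.
    by apply/In_cat; right; apply/In_cat; left; apply/In_map; exists e.
  - have := h ((s, (true, true), e), b3 e); rewrite hw /= ansE; apply.
    by apply/In_cat; right; apply/In_cat; right; apply/In_map; exists e.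
by case/In_cat => [|/In_cat []] /In_map [e [_ ->]]; rewrite hw /= ansE ffunE.
Qed.

Lemma ans_neg O w b : ans O w (~~ b) <-> ~ ans O w b.
Proof. by rewrite !ansE; case: b; case: `[< _ >]. Qed.

Lemma window_word i t1 p1 t2 p2 L : size t1 = L -> size p1 = L -> size t2 = L -> size p2 = L ->
  size (bin i) <= L -> exists w : seq letter,
  [/\ size w = L, map xi w = pad L (bin i), map xj w = pad L (bin i.-1)
    & [/\ map xt1 w = t1, map xp1 w = p1, map xt2 w = t2 & map xp2 w = p2]].
Proof.
move=> s1 s2 s3 s4 si.
have si' : size (bin i.-1) <= L by move: si; rewrite !size_bin; lia.
have z1 : size (pad L (bin i)) = L by rewrite size_pad.
have z2 : size (pad L (bin i.-1)) = L by rewrite size_pad.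
exists (zip (zip (pad L (bin i)) (pad L (bin i.-1))) (zip (zip t1 p1) (zip t2 p2))).
have e1 : size (zip (pad L (bin i)) (pad L (bin i.-1))) = L by rewrite size_zip z1 z2 minnn.
have e2 : size (zip t1 p1) = L by rewrite size_zip s1 s2 minnn.
have e3 : size (zip t2 p2) = L by rewrite size_zip s3 s4 minnn.
have e4 : size (zip (zip t1 p1) (zip t2 p2)) = L by rewrite size_zip e2 e3 minnn.
have m1 U V (a : seq U) (b : seq V) : size a = L -> size b = L -> map fst (zip a b) = a.
  by move=> h1 h2; apply: unzip1_zip; rewrite h1 h2.
have m2 U V (a : seq U) (b : seq V) : size a = L -> size b = L -> map snd (zip a b) = b.
  by move=> h1 h2; apply: unzip2_zip; rewrite h1 h2.
split; first by rewrite size_zip e1 e4 minnn.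
- by rewrite (map_comp fst fst) !m1.
- by rewrite (map_comp snd fst) m1 // m2.
split.
- by rewrite (map_comp fst (fst \o snd)) (map_comp fst snd) m2 // !m1.
- by rewrite (map_comp snd (fst \o snd)) (map_comp fst snd) m2 // m1 // m2.
- by rewrite (map_comp fst (snd \o snd)) (map_comp snd snd) !m2 // m1.
- by rewrite (map_comp snd (snd \o snd)) (map_comp snd snd) !m2.
Qed.

(** Passing all tests forces the claimed bits to be those of the oracle, so the claim is a real
    fault or a real accepting end. Failing to refute an allegation means that all its bits are
    correct, so the earlier fault is real too. *)
Lemma window_verifier : exists N : ATM, SigmaP4_single_query_oracle N /\
  forall x As, accepts_with N x (disj_union As) <-> referee x As.
Proof.
have [N [hN hacc]] := verifier d wut wet wem1 wem2 wtag info_regular.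
exists N; split=> // x As; apply: iff_trans (hacc x _) _.
change ((exists (f : F) (w : seq letter), size w = glen d x /\
  forall w' : seq letter, size w' = glen d x -> forall f' : F,
  let y : seq Y := zip (zip w (padded d x)) w' in
  (forall kb : K * bool, List.In kb (wut f f' (info y)) ->
     ans (disj_union As) (oword wem1 wem2 wtag kb.1 y) kb.2) /\
  (if wet f f' (info y) is Some l
   then exists kb : K * bool, List.In kb l /\ ans (disj_union As) (oword wem1 wem2 wtag kb.1 y) kb.2
   else True)) <-> referee x As).
move=> {hacc}.
have sz : size (padded d x) = glen d x.
  by rewrite size_cat size_map size_nseq.
have hI (w w' : seq letter) : size w = glen d x -> size w' = glen d x ->
    info (zip (zip w (padded d x)) w') =
    (wflags (zip w (padded d x)), wflags (zip w' (padded d x)), index_cmp (zip (map xi w') (map xi w))).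
  move=> s1 s2; rewrite /info -/(unzip1 _) unzip1_zip ?size2_zip ?s1 ?s2 ?sz //.
  move: s1 s2; rewrite -sz => s1 s2; congr (_, wflags _, index_cmp _); move: s1 s2.
    move: (padded d x) w w' {sz} => z; elim: z => [|a z IH] [|b w] [|c w'] //= [s1] [s2].
    by rewrite IH.
  move: (padded d x) w w' {sz} => z; elim: z => [|a z IH] [|b w] [|c w'] //= [s1] [s2].
  by rewrite IH.
split.
- case=> [[[[r b1] b2] b3] [w [sw h]]].
  pose f : F := (r, b1, b2, b3).
  have g : good f (wflags (zip w (padded d x))).
    (* Any opposing claim serves here, such as [f] itself: if [f] were not [good], an element of the
       empty list would be required. *)
    have [_] := h w sw f; rewrite hI // /wet [_.1.1]/= -/f.
    by case: (good f _) => // -[kb []].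
  have sw1 : size w = size (padded d x) by rewrite sz.
  have [i [i0 si hi hj]] : exists i, [/\ 0 < i, size (bin i) <= size w,
      map xi w = pad (size w) (bin i) & map xj w = pad (size w) (bin i.-1)].
    by apply: (wflags_ok sw1); move: g => /andP [].
  have [m1 m2 m3] : [/\ b1 = bitsA As (block1 r i) (map xt1 w) (map xp1 w),
      b2 = bitsA As i (map xt2 w) (map xp2 w)
    & b3 = bitsA As i.-1 (nseq (size w) true) (nseq (size w) true)].
    apply: (ftests_match (s := false) As r b1 b2 b3 sw1 sw1 hi hj).1 => kb hkb.
    by have [+ _] := h w sw f; rewrite hI // /wut [_.1.1]/= -/f g; exact.
  exists i; rewrite -sw; split=> //.
    move: g; rewrite /good (wflagsE sw1 i0) // => /andP [_] /orP [] /and3P []; last first.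
      move=> _ /= i1 ea; right; split; first by lia.
      by rewrite /ev -sw /cellA -m3.
    rewrite /own /= -/(owner i) => /eqP ho hv he; left; split=> //; last first.
      by case/orP: he => [/eqP ->|he]; [left|right; rewrite /ev -sw /cellA -m3].
    move=> /(_ r (map xt1 w) (map xp1 w) (map xt2 w) (map xp2 w)).
    rewrite !size_map -sw /violS /cellA -m1 -m2 hv; case: (r) => r' lr /= hrr.
    by have := hrr lr erefl erefl erefl erefl.
  move=> j /andP [j0 ji] oj r' t1 p1 t2 p2 lr s1 s2 s3 s4.
  apply/negP => hv.
  have sj : size (bin j) <= glen d x by move: si; rewrite sw !size_bin; lia.
  have [w' [sw' ei ej [e1 e2 e3 e4]]] := window_word s1 s2 s3 s4 sj.
  (* The allegation built from the true oracle bits at an earlier fault leaves no bit to refute. *)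
  pose f' : F := (Ordinal lr, bitsA As (block1 r' j) t1 p1, bitsA As j t2 p2,
                  bitsA As j.-1 (nseq (glen d x) true) (nseq (glen d x) true)).
  have sw1' : size w' = size (padded d x) by rewrite sz.
  have hf : wflags (zip w' (padded d x)) = sflags j t1 p1 t2 p2 (padded d x).
    by rewrite (wflagsE sw1' (i := j)) ?sw' ?e1 ?e2 ?e3 ?e4.
  have hb : bad f' (wflags (zip w' (padded d x))) (index_cmp (zip (map xi w') (map xi w))).
    rewrite hf /bad; apply/and4P; split=> //; first by rewrite /own [f_odd _]/= -/(owner j) oj.
    by rewrite ei hi sw index_cmp_oval ?size_pad // -?sw // !oval_pad.
  have [_] := h w' sw' f'; rewrite hI // /wet [_.1.1]/= -/f g [_.1.2]/= [_.2]/= hb.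
  case=> kb [/In_map [kb0 [hk ->]] /=] /ans_neg; apply.
  have hi' : map xi w' = pad (size w') (bin j) by rewrite sw'.
  have hj' : map xj w' = pad (size w') (bin j.-1) by rewrite sw'.
  move: kb0 hk; apply: (ftests_match (s := true) As _ _ _ _ sw1 sw1' hi' hj').2.
  by rewrite e1 e2 e3 e4 sw'.
- case=> i [i0 si hgood hval].
  have [r [t1 [p1 [t2 [p2 [[lr s1 s2 s3 s4] hrr]]]]]] : exists r t1 p1 t2 p2,
      [/\ r < 5, size t1 = glen d x, size p1 = glen d x, size t2 = glen d x & size p2 = glen d x] /\
      ([/\ owner i = false, violS x As i r t1 p1 t2 p2 & i = 1 \/ evact false (ev x As i.-1)] \/
       [/\ r = 4, 1 < i & evacc (ev x As i.-1)]).
    case: hgood => [[ho nv he]|[i1 ea]]; last first.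
      by exists 4, (nseq (glen d x) true), (nseq (glen d x) true),
        (nseq (glen d x) true), (nseq (glen d x) true); rewrite !size_nseq; split=> //; right.
    apply: contrapT => hn; apply: nv => r t1 p1 t2 p2 lr s1 s2 s3 s4.
    apply/negP => hv; apply: hn; exists r, t1, p1, t2, p2; split=> //; by left.
  have [w [sw ei ej [e1 e2 e3 e4]]] := window_word s1 s2 s3 s4 si.
  have sw1 : size w = size (padded d x) by rewrite sz.
  pose f : F := (Ordinal lr, bitsA As (block1 r i) t1 p1, bitsA As i t2 p2,
                  bitsA As i.-1 (nseq (glen d x) true) (nseq (glen d x) true)).
  have hf : wflags (zip w (padded d x)) = sflags i t1 p1 t2 p2 (padded d x).
    by rewrite (wflagsE sw1 (i := i)) ?sw ?e1 ?e2 ?e3 ?e4.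
  have g : good f (wflags (zip w (padded d x))).
    rewrite hf; apply/andP; split=> //; case: hrr => [[ho hv he]|[er i1 ea]]; apply/orP.
      left; apply/and3P; split.
      - by rewrite /own [f_odd _]/= -/(owner i) ho.
      - exact: hv.
      - by case: he => [->|he] //; apply/orP; right.
    right; apply/and3P; split; [by rewrite /= er|by rewrite /=; lia|exact: ea].
  exists f, w; split=> // w' sw' [[[r' b1] b2] b3] y; rewrite /y hI // /wut /wet [_.1.1]/= g [_.1.2]/= [_.2]/=.
  have sw1' : size w' = size (padded d x) by rewrite sz.
  split.
    have hi' : map xi w = pad (size w) (bin i) by rewrite sw.
    have hj' : map xj w = pad (size w) (bin i.-1) by rewrite sw.
    apply: (ftests_match (s := false) As _ _ _ _ sw1 sw1' hi' hj').2.
    by rewrite e1 e2 e3 e4 sw.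
  case: ifP => // hb.
  apply: contrapT => hn.
  have [j [j0 sj hi hj]] : exists i, [/\ 0 < i, size (bin i) <= size w',
      map xi w' = pad (size w') (bin i) & map xj w' = pad (size w') (bin i.-1)].
    by apply: (wflags_ok sw1'); move: hb => /and4P [].
  have [m1 m2 m3] : [/\ b1 = bitsA As (block1 r' j) (map xt1 w') (map xp1 w'),
      b2 = bitsA As j (map xt2 w') (map xp2 w')
    & b3 = bitsA As j.-1 (nseq (size w') true) (nseq (size w') true)].
    apply: (ftests_match (s := true) As r' b1 b2 b3 sw1 sw1' hi hj).1 => kb hkb.
    apply: contrapT => /ans_neg na; apply: hn; exists (kb.1, ~~ kb.2); split=> //.
    by apply/In_map; exists kb.
  move: hb; rewrite /bad (wflagsE sw1' (i := j)) // => /and4P [_].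
  rewrite /own [f_odd _]/= -/(owner j) => /eqP oj hv.
  rewrite hi ei sw' index_cmp_oval ?size_pad -?sw' // ?sw' // !oval_pad => lt.
  have := hval j _ oj r' (map xt1 w') (map xp1 w') (map xt2 w') (map xp2 w').
  rewrite j0 lt !size_map sw' /violS /cellA -m1 -m2 hv.
  by case: (r') => ? lr' /(_ isT lr' erefl erefl erefl erefl).
Qed.

End Windows.

(** * The game *)

Lemma game_mono b k H (P Q : seq (seq bool -> Prop) -> Prop) :
  (forall As, P As -> Q As) -> game b k H P -> game b k H Q.
Proof.
elim: k b P Q => [|k IH] b P Q h /=; first exact: h.
case: b => [[A [hA g]]|g A hA].
  by exists A; split=> //; apply: IH g => As; exact: h.
by apply: IH (g A hA) => As; exact: h.
Qed.

Lemma game_const b k H (Q : Prop) : game b k H (fun=> Q) <-> Q.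
Proof.
elim: k b => [|k IH] b //=; case: b.
  split=> [[A [_ /IH]] //|q]; exists (fun=> False); split=> //; exact/IH.
split=> [h|q A _]; last exact/IH.
by have /IH := h (fun=> False) (fun=> False_ind _).
Qed.

Section Game.
Variables (M : ATM) (x : seq bool) (Qsig : bool) (d gx T : nat).
Hypothesis hq : qry M = None.
Hypothesis hk : kind (start M) = if Qsig then KEx else KUn.
Notation O0 := (fun _ : seq bool => False).
Notation init := (init_cfg M).
Hypothesis htime : forall cs, is_path x O0 init cs -> size cs <= T.
Hypothesis halt : forall cs, is_path x O0 init cs ->
  nblocks (pmap (@label M) (init :: cs)) <= gx.
Let L := glen d x.
Let N := npos L.
Hypothesis hL : 1 < L.
Hypothesis hT : T.+3 < 2 ^ L.-1.

Notation D := (cell M : finType).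
Definition mact b (e : D) := activ b (dst e) (drd e).
Definition macc (e : D) := accst (dst e) (drd e).
Notation vld := (valid (@hrel M) (@vrel M) (@irel M) Qsig d x).
Notation cel := (@cellA D).
Notation evd := (@ev D d x).
Notation ref := (referee (@hrel M) (@vrel M) (@irel M) mact macc Qsig d x).
Notation own := (owner Qsig).
Notation ones := (nseq L true).
Implicit Type c : cfg M.
Implicit Type As : seq (seq bool -> Prop).

Lemma cel_cat As Bs i t p : i <= size As -> cel (As ++ Bs) i t p = cel As i t p.
Proof.
move=> li; congr decB; apply/ffunP => e; rewrite !ffunE; apply: asbool_equiv_eq.
rewrite !disj_unionE size_cat nth_cat; case: i li => [|i] li; first by split; case.
by rewrite li leq_addr (leq_trans li) ?leq_addr.
Qed.

Lemma cel_out As i t p : size As < i -> cel As i t p = None.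
Proof.
move=> li; rewrite /cellA /decB; case: pickP => // e; rewrite ffunE => /asboolP.
by rewrite disj_unionE => -[/andP [_ h] _]; move: li; rewrite ltnNge h.
Qed.

(** The rules for block [i] read only the blocks [i] and [i.-1], so later moves of the game cannot
    change the verdict. *)
Lemma vld_cat As Bs i : i <= size As -> vld (As ++ Bs) i <-> vld As i.
Proof.
move=> li.
have e r t1 p1 t2 p2 : violS (@hrel M) (@vrel M) (@irel M) Qsig d x (As ++ Bs) i r t1 p1 t2 p2
    = violS (@hrel M) (@vrel M) (@irel M) Qsig d x As i r t1 p1 t2 p2.
  rewrite /violS !cel_cat // /block1; case: ifP => // _.
  exact: leq_trans (leq_pred _) li.
by split=> h r t1 p1 t2 p2 *; have := h r t1 p1 t2 p2; rewrite e; apply.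
Qed.

Lemma vld_rcons As A Bs :
  vld (As ++ A :: Bs) (size As).+1 <-> vld (rcons As A) (size As).+1.
Proof. by rewrite -cat_rcons; apply: vld_cat; rewrite size_rcons. Qed.

Lemma ownS i : own i.+1 = ~~ own i.
Proof. by rewrite /owner /=; case: odd; rewrite ?negbK. Qed.

Lemma N_gt : T.+3 < N.
Proof. by rewrite /N /npos; apply: leq_trans hT _; exact: leq_addl. Qed.

Lemma start_label : klab (start M) = Some Qsig.
Proof. by rewrite /klab hk; case: Qsig. Qed.

Lemma reach_time c k nb : reach x c k nb -> k <= T.
Proof.
have h : klab (start M) != None by rewrite start_label.
by move=> /(reach_path hq h) [cs [/htime + _ <- _]].
Qed.

Lemma reach_alt c k nb : reach x c k nb -> nb <= gx.
Proof.
have h : klab (start M) != None by rewrite start_label.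
by move=> /(reach_path hq h) [cs [/halt + _ _ <-]].
Qed.

Lemma reach_hposN c k nb o : reach x c k nb -> hpos c o < N.
Proof.
move=> r; apply: leq_ltn_trans (reach_hpos hq o r) _.
by apply: leq_ltn_trans (reach_time r) _; have := N_gt; lia.
Qed.

Lemma bsteps_hposN b n c c' k nb o : reach x c k nb -> bsteps x b n c c' -> hpos c' o < N.
Proof. by move=> r h; have := bsteps_reach h r; case=> [k' [nb' [r' _ _ _]]]; exact: reach_hposN r'. Qed.

Lemma isym_padded p : isym M (nth None (padded d x) p) = nth (blank M) (map (sym M) x) p.
Proof.
rewrite /padded nth_cat size_map; case: ltnP => h.
  by rewrite (nth_map false) // (nth_map false).
by rewrite nth_nseq if_same nth_default ?size_map.
Qed.

Lemma inpw_padded w : size w = L -> inpw (zip w (padded d x)) = nth None (padded d x) (pos w).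
Proof.
move=> sw; have sz : size (padded d x) = L by rewrite size_cat size_map size_nseq.
rewrite inpw_pos ?sw ?sz // => j lj; rewrite nth_cat size_map ifF ?nth_nseq ?if_same //.
apply/negbTE; rewrite -leqNgt.
have h : 0 < (size x).+2 ^ d by rewrite expn_gt0.
by move: lj; rewrite /L /glen; lia.
Qed.

Lemma first_address v : v < N -> firstw (address L v) = (v == 0).
Proof. by move=> lv; rewrite firstw_pos ?size_address ?pos_address //; lia. Qed.

Lemma last_address v : v < N -> all id (address L v) = (v.+1 == N).
Proof.
move=> lv; apply/idP/eqP => [/all_id_nseq|e].
  rewrite size_address; last by lia.
  by move=> e; rewrite -(pos_address hL lv) e pos_last // prednK //; lia.
have -> : v = N.-1 by lia.
by rewrite address_last // all_nseq orbT.
Qed.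

Lemma orel_Some (r : rel D) o o' : orel r o o' ->
  exists e e', [/\ o = Some e, o' = Some e' & r e e'].
Proof. by case: o o' => [e|] // [e'|] //= h; exists e, e'. Qed.

(** Row 0 of the first block is the initial configuration, while row 0 of a later block is already
    one step beyond the preceding block. *)
Definition blen m := if m == 0 then N.-1 else N.

(** The position after faultless blocks [As] that lead to [c]. By [i_reach] an active run has used
    more than [size As] alternations, so it has halted once the bound is reached. [i_early] finds an
    accepting end at a block whose successor still has a number of at most [L] bits, however large
    [size As] is. *)
Record inv As c := Inv {
  i_valid : forall j, 0 < j <= size As -> vld As j;
  i_row : if size As == 0 then c = init else
    exists ch, forall v, v < N -> cel As (size As) ones (address L v) = Some (hon x c ch v);
  i_reach : exists k nb, reach x c k nb /\ forall b, actc x b c -> size As < nb;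
  i_stop : 0 < size As -> ~~ actc x (own (size As)) c;
  i_acc : forall j, 0 < j <= size As -> evacc macc (evd As j) -> accc x c;
  i_early : accc x c -> 0 < size As -> exists j,
    [/\ 0 < j <= size As, j.+1 < 2 ^ L & evacc macc (evd As j)]
}.

Lemma T_lt : T.+3 < 2 ^ L.
Proof. by apply: leq_trans hT _; rewrite leq_exp2l //; lia. Qed.

Lemma ev_row As c ch i : (forall v, v < N -> cel As i ones (address L v) = Some (hon x c ch v)) ->
  evd As i = Some (hon x c ch N.-1).
Proof.
by move=> h; rewrite /ev -/L -{2}address_last // h //; have := N_gt; lia.
Qed.

(** If the new owner is active at [c], the block exhausts that player's moves, and activity at [c']
    means one more alternation. Otherwise nobody is active at [c], the block only stutters, and all
    is inherited. *)
Lemma inv_step As c A c' (As' := rcons As A) : inv As c ->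
  bsteps x (own (size As).+1) (blen (size As)) c c' ->
  vld As' (size As).+1 ->
  (exists ch, forall v, v < N -> cel As' (size As).+1 ones (address L v) = Some (hon x c' ch v)) ->
  inv As' c'.
Proof.
set m := size As; set b := own m.+1 => -[iv ir [k [nb [r hnb]]] is_ ia ie] hb hv [ch hrow].
have sz : size As' = m.+1 by rewrite size_rcons.
have eAs : As' = As ++ [:: A] by rewrite cats1.
have [k' [nb' [r' le lt hact]]] := bsteps_reach hb r.
have hev : evd As' m.+1 = Some (hon x c' ch N.-1) by exact: ev_row.
(* An owner still active at the end would have made at least [N.-1] real steps, more than [T]. *)
have stop : ~~ actc x b c'.
  apply/negP => /hact ek; have := reach_time r'; rewrite ek /blen.
  by have := N_gt; case: (m == 0); lia.
have inact : (forall b', ~~ actc x b' c) -> c' = c.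
  by move=> h; exact: bsteps_inactive (h b) hb.
have act_b b' : actc x b' c -> b' = b.
  move=> a; case: (posnP m) => [m0|mp].
    move: ir a; rewrite -/m m0 /= => -> /andP [/eqP]; rewrite /= start_label => -[<-] _.
    by rewrite /b m0.
  have := is_ mp; rewrite /b ownS -/m.
  by case: (own m) => /negbTE h; case: b' a => //; rewrite h.
constructor; rewrite sz.
- move=> j /andP [j0]; rewrite leq_eqVlt => /orP [/eqP -> //|lj].
  by rewrite eAs; apply/vld_cat => //; apply: iv; rewrite j0.
- by exists ch.
- exists k', nb'; split=> // b' a'.
  case: (boolP (actc x b c)) => a.
    have lab : klab (cst c) = Some b by move: a => /andP [/eqP].
    apply: leq_trans (lt lab _); first by rewrite ltnS (hnb b).
    move: a' stop; rewrite /actc /activ => /andP [/eqP -> h].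
    by rewrite h andbT; case: (b') (b) => [] [].
  have ec : c' = c by exact: bsteps_inactive a hb.
  by move: a' (a'); rewrite {1}ec => /act_b -> a'; rewrite a' in stop.
- by [].
- move=> j /andP [j0]; rewrite leq_eqVlt => /orP [/eqP ->|lj]; first by rewrite hev.
  rewrite /ev eAs cel_cat // => h.
  have ac : accc x c by apply: (ia j); rewrite ?j0.
  by rewrite inact // => b'; exact: accc_halted.
- move=> ac _; case: (boolP (actc x b c)) => a.
    exists m.+1; split; rewrite ?leqnn //; last by rewrite hev.
    have := hnb _ a; have := reach_le r; have := reach_time r; have := T_lt; rewrite -/m; lia.
  have ec : c' = c by exact: bsteps_inactive a hb.
  case: (posnP m) => [m0|mp].
    exists m.+1; split; rewrite ?leqnn //; last by rewrite hev.
    by rewrite m0; have := T_lt; lia.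
  rewrite ec in ac; have [j [/andP [j0 jm] lj ea]] := ie ac mp.
  exists j; split=> //; first by rewrite j0 leqW.
  by rewrite /ev eAs cel_cat.
Qed.

Lemma rows_sound b n R c0 ch0 k nb : reach x c0 k nb ->
  (forall t, t < N -> row_ok N (R t)) ->
  (forall t p, t.+1 < N -> p < N -> vrel b (p == 0) (p.+1 == N) (R t p) (R t.+1 p)) ->
  (forall p, p < N -> R 0 p = hon x c0 ch0 p) -> n < N ->
  exists c', bsteps x b n c0 c' /\ exists ch, forall p, p < N -> R n p = hon x c' ch p.
Proof.
move=> r hok hv h0; elim: n => [|n IH] ln; first by exists c0; split=> //; exists ch0.
have [c1 [hb [ch h1]]] := IH (ltnW ln).
have N0 : 0 < N by exact: leq_trans ln.
have hN c' : bstep x b c1 c' -> forall o, hpos c' o < N.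
  by move=> h o; exact: bsteps_hposN r (bsteps_rcons hb h).
have hv' p : p < N -> vrel b (p == 0) (p.+1 == N) (R n p) (R n.+1 p) by exact: hv.
have [c' [h2 h3]] := row_step hq (hok _ ln) N0 hN h1 hv'.
by exists c'; split; [exact: bsteps_rcons hb h2 | exists (dch (R n.+1 0))].
Qed.

(** Only canonical addresses are inspected. Rule 3 or rule 2 fixes row 0, and rules 0 and 1
    propagate correctness row by row; the time bound keeps all heads inside the rows. *)
Lemma valid_sound As c A (As' := rcons As A) : inv As c -> vld As' (size As).+1 ->
  exists c', bsteps x (own (size As).+1) (blen (size As)) c c' /\
  exists ch, forall v, v < N -> cel As' (size As).+1 ones (address L v) = Some (hon x c' ch v).
Proof.
set m := size As; set b := own m.+1 => -[iv ir [k [nb [r _]]] _ _ _] hv.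
have N2 : 1 < N by have := N_gt; lia.
have sa v : size (address L v) = L by rewrite size_address //; lia.
have cell_h t p : t < N -> p.+1 < N ->
    orel (@hrel M) (cel As' m.+1 (address L t) (address L p)) (cel As' m.+1 (address L t) (address L p.+1)).
  move=> lt lp; have := hv 0 (address L t) (address L p) (address L t) (address L p.+1) isT (sa _) (sa _) (sa _) (sa _).
  by rewrite /violS /= eqxx adj_address //= => /negbFE.
have cell_v t p : t.+1 < N -> p < N ->
    orel (@vrel M b (p == 0) (p.+1 == N)) (cel As' m.+1 (address L t) (address L p))
         (cel As' m.+1 (address L t.+1) (address L p)).
  move=> lt lp; have := hv 1 (address L t) (address L p) (address L t.+1) (address L p) isT (sa _) (sa _) (sa _) (sa _).
  by rewrite /violS /= adj_address // eqxx canonw_address //= first_address // last_address // => /negbFE.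
pose e0 : D := hon x init ord0 0.
pose R t p : D := odflt e0 (cel As' m.+1 (address L t) (address L p)).
(* An undecodable cell violates rule 0, and since [1 < N] every cell has a horizontal neighbour. *)
have cR t p : t < N -> p < N -> cel As' m.+1 (address L t) (address L p) = Some (R t p).
  move=> lt lp; rewrite /R; case: (ltnP p.+1 N) => lp1.
    by have [e [e' [-> _ _]]] := orel_Some (cell_h t p lt lp1).
  have ep : p = p.-1.+1 by lia.
  have lp' : p.-1.+1 < N by rewrite -ep.
  by have [e [e' [_ + _]]] := orel_Some (cell_h t _ lt lp'); rewrite -ep => ->.
have hR_h t p : t < N -> p.+1 < N -> hrel (R t p) (R t p.+1).
  by move=> lt lp; have := cell_h t p lt lp; rewrite !cR // ltnW.
have hR_v t p : t.+1 < N -> p < N -> vrel b (p == 0) (p.+1 == N) (R t p) (R t.+1 p).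
  by move=> lt lp; have := cell_v t p lt lp; rewrite !cR // ltnW.
have N0 : 0 < N by exact: ltnW.
have fin c0 ch0 n : reach x c0 n.1 n.2 -> (forall p, p < N -> urel (p == 0) (p.+1 == N) (R 0 p)) ->
    (row_ok N (R 0) -> forall p, p < N -> R 0 p = hon x c0 ch0 p) ->
    exists c', bsteps x b N.-1 c0 c' /\
    exists ch, forall v, v < N -> cel As' m.+1 ones (address L v) = Some (hon x c' ch v).
  move=> r0 hu h0.
  have hok t : t < N -> row_ok N (R t).
    move=> lt; split=> p lp; first exact: hR_h.
    by case: t lt => [|t] lt; [exact: hu | have /andP [] := hR_v t p lt lp].
  have lN : N.-1 < N by rewrite prednK.
  have [c' [h1 [ch h2]]] := rows_sound r0 hok hR_v (h0 (hok 0 N0)) lN.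
  exists c'; split=> //; exists ch => v lv.
  by rewrite -address_last // cR // h2.
case: (boolP (m == 0)) => [/eqP m0|mp]; last rewrite -lt0n in mp.
  have ec : c = init by move: ir; rewrite -/m m0.
  have hi p : p < N -> irel (nth None (padded d x) p) (p == 0) (p.+1 == N) (R 0 p).
    move=> lp; have := hv 3 (address L 0) (address L p) (address L 0) (address L p) isT (sa _) (sa _) (sa _) (sa _).
    have e1 : (m.+1 == 1) = true by rewrite m0.
    rewrite /violS /= e1 !first_address // cR // last_address //.
    by rewrite inpw_padded // pos_address //= => /negbFE.
  have -> : blen m = N.-1 by rewrite /blen m0.
  rewrite ec.
  apply: (fin init (dch (R 0 0)) (0, 1)) => [|p lp|hok].
  - exact: reach0.
  - by have /and3P [] := hi p lp.
  - by apply: (row_init hok N0 (z := nth None (padded d x))) => // p _; rewrite isym_padded.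
move: ir; rewrite -/m (negbTE (lt0n_neq0 mp)) => -[ch hc].
have hl p : p < N -> vrel b (p == 0) (p.+1 == N) (hon x c ch p) (R 0 p).
  move=> lp; have sn : size ones = L by rewrite size_nseq.
  have := hv 2 ones (address L p) (address L 0) (address L p) isT sn (sa _) (sa _) (sa _).
  rewrite /violS /= eqSS (negbTE (lt0n_neq0 mp)) all_nseq orbT first_address // eqxx.
  rewrite canonw_address // first_address // last_address // cR //=.
  by rewrite /As' -cats1 cel_cat // hc //= eqxx => /negbFE.
have hN c' : bstep x b c c' -> forall o, hpos c' o < N.
  by move=> h o; apply: (bsteps_hposN (b := b) (n := 1) o r); exists c'.
have hu p : p < N -> urel (p == 0) (p.+1 == N) (R 0 p) by move=> lp; have /andP [] := hl p lp.
have hok : row_ok N (R 0) by split=> // p lp; exact: hR_h.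
have [c1 [h1 h2]] := row_step hq hok N0 hN (R := hon x c ch) (fun _ _ => erefl) hl.
have hb1 : bsteps x b 1 c c1 by exists c1.
have [k' [nb' [r' _ _ _]]] := bsteps_reach hb1 r.
have [c' [h3 h4]] := fin c1 (dch (R 0 0)) (k', nb') r' hu (fun=> h2).
exists c'; split=> //; rewrite /blen -/m (negbTE (lt0n_neq0 mp)).
have -> : N = N.-1.+1 by rewrite prednK.
by exists c1.
Qed.
(** The set records the given steps at all addresses through [pos], including the non-canonical
    ones, so that no window whatever exhibits a fault. *)
Lemma honest_block As c c' : inv As c ->
  bsteps x (own (size As).+1) (blen (size As)) c c' ->
  exists A, [/\ forall w, A w -> size w = 2 * L + #|D|, vld (rcons As A) (size As).+1
    & exists ch, forall v, v < N ->
        cel (rcons As A) (size As).+1 ones (address L v) = Some (hon x c' ch v)].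
Proof.
set m := size As; set b := own m.+1; set n := blen m => -[iv ir [k [nb [r _]]] _ _ _] hb.
have [C [C0 Cn hC]] := bsteps_fun hb.
have hCb j : j <= n -> bsteps x b j c (C j).
  by elim: j => [|j IH] lj //=; apply: bsteps_rcons (IH (ltnW lj)) (hC j lj).
have hN j o : j <= n -> hpos (C j) o < N by move=> lj; exact: bsteps_hposN r (hCb j lj).
have [chf hch] : exists chf : nat -> 'I_(dmax M).+1, forall j, j < n ->
    forall ch p (last : bool), (last -> forall o, hpos (C j.+1) o != p.+1) ->
    vrel b (p == 0) last (hon x (C j) ch p) (hon x (C j.+1) (chf j) p).
  suff hx j : exists ch', j < n -> forall ch p (last : bool),
      (last -> forall o, hpos (C j.+1) o != p.+1) ->
      vrel b (p == 0) last (hon x (C j) ch p) (hon x (C j.+1) ch' p).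
    by have [chf h] := boolp.choice hx; exists chf.
  case: (ltnP j n) => lj; last by exists ord0.
  by have [ch' h] := vrel_hon hq (hC j lj); exists ch'.
(* The shift of one step between row 0 of a later block and the last row before it. *)
pose s : nat := m != 0.
pose chr j := if j is j'.+1 then chf j' else ord0.
pose e t p : D := hon x (C (s + pos t)) (chr (s + pos t)) (pos p).
pose A u := exists t p, [/\ size t = L, size p = L & u = tail t p (e t p)].
have N2 : 1 < N by have := N_gt; lia.
have sn : s + N.-1 = n by rewrite /s /n /blen; case: (m == 0) => /=; lia.
have posN w : size w = L -> pos w < N by move=> sw; rewrite /N -sw; apply: pos_lt; rewrite sw.
have hA t p : size t = L -> size p = L -> cel (rcons As A) m.+1 t p = Some (e t p).
  move=> st sp.
  have hbit e' : bitsA D (rcons As A) m.+1 t p e' = (e' == e t p).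
    rewrite ffunE; apply/asboolP/eqP => [|->].
      rewrite disj_unionE nth_rcons ltnn eqxx => -[_ [t' [p' [st' sp' he]]]].
      by have [-> -> ->] := tail_inj (etrans st (esym sp)) (etrans st' (esym sp')) (etrans sp (esym sp')) he.
    rewrite disj_unionE nth_rcons ltnn eqxx size_rcons leqnn; split=> //.
    by exists t, p.
  rewrite /cellA /decB; case: pickP => [e'|/(_ (e t p))]; last by rewrite hbit eqxx.
  by rewrite hbit => /eqP ->.
have lastN p (last : bool) : size p = L -> (last -> all id p) -> forall j, j <= n ->
    last -> forall o, hpos (C j) o != (pos p).+1.
  move=> sp hl j lj l o; have /all_id_nseq := hl l; rewrite sp => ->.
  rewrite pos_last // prednK; last exact: ltnW.
  by rewrite neq_ltn hN.
exists A; split.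
- by move=> w [t [p [st sp ->]]]; rewrite size_tail ?st ?sp.
- move=> rr t1 p1 t2 p2 _ s1 s2 s3 s4; rewrite /violS (hA t2 p2) //; apply/negP.
  have fp : firstw p2 = (pos p2 == 0) by apply: firstw_pos; rewrite s4.
  case: rr => [|[|[|[|//]]]] /=.
  + move=> /and3P [/eqP et ap]; rewrite /block1 /= hA //= -et /e.
    by rewrite (adj_pos _ ap) ?s2 ?s4 // hrel_hon.
  + move=> /and3P [at_ /andP [/eqP ep _]]; rewrite /block1 /= hA //= ep /e fp.
    have et : pos t2 = (pos t1).+1 by apply: adj_pos at_; rewrite s1 s3.
    rewrite et addnS /=.
    have lj : s + pos t1 < n by rewrite -sn; have := posN t2 s3; rewrite et; lia.
    by rewrite hch //; exact: lastN.
  + rewrite eqSS => /and5P [mp lt ft /andP [/eqP ep cp]].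
    move: ir; rewrite -/m (negbTE mp) => -[ch hc].
    rewrite /block1 /= -cats1 cel_cat //.
    have -> : t1 = ones by rewrite (all_id_nseq lt) s1.
    (* The preceding block may be the opponent's and is known only at canonical addresses, hence the
       condition [canonw] on windows. *)
    have -> : p1 = address L (pos p1) by rewrite {1}(canonwP cp) s2.
    rewrite hc ?posN //= ep /e.
    have -> : pos t2 = 0 by apply/eqP; rewrite -firstw_pos // s3.
    have -> : s + 0 = 1 by rewrite /s mp.
    have lj : 0 < n by rewrite -sn /s mp.
    by rewrite fp -C0 /= hch //; exact: lastN.
  + rewrite eqSS => /and3P [/eqP m0 ft].
    have ec : c = init by move: ir; rewrite -/m m0.
    rewrite /e; have -> : pos t2 = 0 by apply/eqP; rewrite -firstw_pos // s3.
    have -> : s + 0 = 0 by rewrite /s m0.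
    rewrite C0 ec fp irel_hon //.
    by rewrite inpw_padded // isym_padded.
- exists (chr n) => v lv.
  rewrite hA ?size_nseq ?size_address //; last by lia.
  by rewrite /e pos_last // -/N sn Cn pos_address.
Qed.

Lemma accc_acc c : accc x c -> accepts x O0 c.
Proof. by move=> a; apply/(acc_halted hq) => // b; exact: accc_halted. Qed.

Lemma evd_inv As c : inv As c -> 0 < size As ->
  exists ch, evd As (size As) = Some (hon x c ch N.-1).
Proof.
move=> hi sp; have := i_row hi; rewrite (negbTE (lt0n_neq0 sp)) => -[ch h].
by exists ch; exact: ev_row.
Qed.

Lemma early_win As Bs c : inv As c -> accc x c -> 0 < size As -> ref (As ++ Bs).
Proof.
move=> hi ac sp; have [j [/andP [j0 lj] jL ea]] := i_early hi ac sp.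
exists j.+1; split=> //; first by rewrite size_bin.
  by right; split=> //=; rewrite /ev cel_cat.
move=> j' /andP [j0' lj'] _; have le : j' <= size As by apply: leq_trans lj.
by apply/vld_cat => //; apply: i_valid hi _ _; rewrite j0'.
Qed.

Lemma evacc_inv As Bs c i : inv As c -> 1 < i -> i.-1 <= size As ->
  evacc macc (evd (As ++ Bs) i.-1) -> accc x c.
Proof.
move=> hi i1 li; rewrite /ev cel_cat // => ea; apply: (i_acc hi _ ea).
by rewrite li andbT; lia.
Qed.

(** Induction on the remaining blocks. Valid moves correspond to genuine continuations in both
    directions, and an invalid move fixes the outcome whatever follows. With no block left, the run
    has halted and the referee can only win by an accepting end. *)
Lemma game_acc k As c : inv As c -> size As + k = gx -> 0 < gx ->
  game (own (size As).+1) k (2 * L + #|D|) (fun Bs => ref (As ++ Bs)) <-> accepts x O0 c.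
Proof.
elim: k As c => [|k IH] As c hi sk g0.
  rewrite addn0 in sk; have sp : 0 < size As by rewrite sk.
  have halted b : ~~ actc x b c.
    apply/negP => a; have [k [nb [r hnb]]] := i_reach hi.
    by have := reach_alt r; rewrite -sk leqNgt (hnb b).
  rewrite (acc_halted hq) //= cats0; split=> [[i [i0 si hw _]]|ac]; last first.
    by rewrite -(cats0 As); exact: early_win hi ac sp.
  have ev_out : size As < i.-1 -> evd As i.-1 = None by exact: cel_out.
  case: hw => [[oi nv he]|[i1 ea]]; last first.
    case: (leqP i.-1 (size As)) => li; last by rewrite ev_out in ea.
    by apply: (evacc_inv (Bs := [::]) hi i1 li); rewrite cats0.
  case: (leqP i (size As)) => li.
    by case: nv; apply: i_valid hi _ _; rewrite i0.
  case: he => [i1|]; first by move: li; rewrite i1 ltnNge sp.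
  case: (ltnP (size As) i.-1) => li2; first by rewrite ev_out.
  have -> : i.-1 = size As by lia.
  have [ch ->] := evd_inv hi sp.
  by rewrite /= /mact /= -/(actc _ _ _) (negbTE (halted false)).
have ext A c' : inv (rcons As A) c' ->
    game (~~ own (size As).+1) k (2 * L + #|D|) (fun Bs => ref (As ++ A :: Bs)) <-> accepts x O0 c'.
  move=> hi'; rewrite -(IH _ _ hi' _ g0) ?size_rcons ?addSnnS // -ownS.
  by split; apply: game_mono => Bs; rewrite cat_rcons.
case: (boolP (own (size As).+1)) => o; rewrite /=.
  split.
    case=> A [hA g].
    have [hv|nv] := pselect (vld (rcons As A) (size As).+1).
      have [c' [hb hrow]] := valid_sound hi hv.
      have hi' := inv_step hi hb hv hrow.
      rewrite o in hb; rewrite (acc_bsteps_ex x hq (blen (size As))); exists c'; split=> //.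
      by apply/(ext A c' hi'); rewrite o.
    (* After a fault of the existential player the referee can only appeal to what precedes it:
       universal faults there are excluded by the invariant, and an accepting end means that [c]
       already accepts. *)
    have : game false k (2 * L + #|D|) (fun=> accepts x O0 c).
      apply: game_mono g => Bs [i [i0 si hw hval]].
      have li : i <= (size As).+1.
        rewrite leqNgt; apply/negP => lt.
        by have := hval (size As).+1; rewrite lt /= => /(_ isT o) /vld_rcons.
      case: hw => [[oi nvi he]|[i1 ea]]; last first.
        by apply: accc_acc; apply: (evacc_inv hi i1 _ ea); lia.
      move: li; rewrite leq_eqVlt => /orP [/eqP ei|li]; first by rewrite ei o in oi.
      by case: nvi; apply/vld_cat => //; apply: i_valid hi _ _; rewrite i0.
    by move/game_const.
  rewrite (acc_bsteps_ex x hq (blen (size As))) => -[c' [hb ac]].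
  rewrite -o in hb; have [A [hA hv hrow]] := honest_block hi hb.
  exists A; split=> //; have := (ext A c' (inv_step hi hb hv hrow)).2 ac.
  by rewrite o.
split=> [g|ac A hA].
  rewrite (acc_bsteps_un x hq (blen (size As))) => c' hb.
  rewrite -(negbTE o) in hb; have [A [hA hv hrow]] := honest_block hi hb.
  apply: (ext A c' (inv_step hi hb hv hrow)).1; rewrite (negbTE o); exact: g.
have [hv|nv] := pselect (vld (rcons As A) (size As).+1).
  have [c' [hb hrow]] := valid_sound hi hv.
  have hi' := inv_step hi hb hv hrow.
  have := (ext A c' hi').2; rewrite (negbTE o) => h; apply: h.
  rewrite (negbTE o) in hb; exact: (acc_bsteps_un x hq (blen (size As)) c).1 ac _ hb.
(* A fault of the universal player wins for the referee at once in block 1, or while the run is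
   active; if the run has halted, it has accepted, and [early_win] applies. *)
suff hw Bs : ref (As ++ A :: Bs) by apply: (game_mono (P := fun=> True)) => //; exact/game_const.
have nv' : ~ vld (As ++ A :: Bs) (size As).+1.
  by move/vld_rcons.
have hval j : 0 < j < (size As).+1 -> own j = true -> vld (As ++ A :: Bs) j.
  move=> /andP [j0]; rewrite ltnS => lj _; apply/vld_cat => //.
  by apply: i_valid hi _ _; rewrite j0.
case: (posnP (size As)) => [s0|sp].
  exists (size As).+1; split=> //.
    by rewrite size_bin s0 -/L; have := T_lt; lia.
  by left; split=> //; [exact/negbTE | left; rewrite s0].
case: (boolP (accc x c)) => [ac'|nac]; first exact: early_win hi ac' sp.
have [k' [nb [r hnb]]] := i_reach hi.
have [b a] : exists b, actc x b c.
  apply: contrapT => hn; move: nac; rewrite (_ : accc x c) //.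
  by apply/(acc_halted hq) => // b; apply/negP => a; apply: hn; exists b.
(* The preceding block belongs to the existential player, who has stopped. *)
have eb : b = false.
  have := i_stop hi sp; have := ownS (size As); rewrite (negbTE o).
  by case: (own (size As)) => // _ h; case: b a => // a; rewrite a in h.
exists (size As).+1; split=> //.
  rewrite size_bin -/L; have := hnb _ a; have := reach_le r; have := reach_time r; have := T_lt; lia.
left; split=> //; [exact/negbTE|right] => /=.
rewrite /ev cel_cat // -/(evd As (size As)); have [ch ->] := evd_inv hi sp.
by rewrite /= /mact /= -eb.
Qed.

Lemma inv0 : inv [::] init.
Proof.
constructor=> //.
- by case.
- by exists 0, 1; split=> //; exact: reach0.
- by case.
Qed.

End Game.

(** * Choice of the parameters *)

Lemma polyn_bound (q : seq nat) : exists d, forall n, polyn q n + 4 <= n.+2 ^ d.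
Proof.
pose S := \sum_(i < size q) nth 0 q i; exists (S + 4 + size q) => n.
have h1 : polyn q n <= S * n.+2 ^ size q.
  rewrite /polyn /S big_distrl /=; apply: leq_sum => i _; rewrite leq_mul2l.
  apply/orP; right; apply: (@leq_trans (n.+2 ^ i)); first by case: (nat_of_ord i) => // j; rewrite leq_exp2r //; lia.
  by rewrite leq_exp2l // ltnW.
have h2 : S + 4 <= n.+2 ^ (S + 4).
  by apply: ltnW; apply: (leq_trans (ltn_expl _ (isT : 1 < 2))); rewrite leq_exp2r //; lia.
rewrite expnD; apply: leq_trans (_ : (S + 4) * n.+2 ^ size q <= _); last by rewrite leq_mul2r h2 orbT.
rewrite mulnDl leq_add //; have : 0 < n.+2 ^ size q by rewrite expn_gt0.
by lia.
Qed.

Theorem theorem8 (Qsig : bool) (g : nat -> nat) (hg : forall n, 1 <= g n)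
  (M : ATM) (hM : QE_machine Qsig g M) :
  exists (h : seq nat) (N : ATM),
    SigmaP4_single_query_oracle N /\
    forall x : seq bool,
      accepts_with M x (fun _ => False) <->
      game Qsig (g (size x)) (polyn h (size x))
           (fun As => accepts_with N x (disj_union As)).
Proof.
case: hM => hq [hk [[q hT] halt]].
have [d hd] := polyn_bound q.
have [N [hN hacc]] := window_verifier (@hrel M) (@vrel M) (@irel M) (@mact M) (@macc M) Qsig d.
pose K : nat := #|(cell M : finType)|.
exists (polyseq (2%N%:P * glen_poly d + K%:P)%R), N; split=> // x.
have eH : polyn (polyseq (2%N%:P * glen_poly d + K%:P)%R) (size x) = 2 * glen d x + K.
  by rewrite polynE hornerD_nat hornerM_nat !hornerC glen_polyE.
have hL : polyn q (size x) + 4 <= glen d x by apply: leq_trans (hd _) (leq_addl _ _).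
have hL1 : 1 < glen d x by lia.
(* The constant 4 of [polyn_bound] is spent here: one unit for the predecessor, and three for the
   factor 8 that absorbs the added 3. *)
have hT' : (2 ^ polyn q (size x)).+3 < 2 ^ (glen d x).-1.
  apply: (@leq_trans (2 ^ (polyn q (size x) + 3))); last by rewrite leq_exp2l //; lia.
  rewrite expnD; have : 0 < 2 ^ polyn q (size x) by rewrite expn_gt0.
  by lia.
have := game_acc hq hk (fun cs => hT x _ cs) (fun cs => halt x _ cs) hL1 hT'
  (inv0 M x Qsig d) (add0n _) (hg (size x)).
rewrite eH /accepts_with => <-.
by split; apply: game_mono => As /hacc.
Qed.
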